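(* Let $d\ge 1$. Let $\varrho$ be a probability density on $\mathbb R^d$ with $\varrho(x)=\varrho(-x)$ and $\int x_ix_j\varrho(x)\,dx=\sigma_\varrho^2\delta_{ij}$ for $1\le i,j\le d$, where $\sigma_\varrho>0$. Assume that $\varrho$ is bounded above by a constant and that there is $\delta>0$ such that $\int|x|^{\max\{2,d-2+\delta\}}\varrho(x)dx<\infty$. Let $\mu$ be a Radon measure on $\mathbb R^d$ that does not charge polar sets and has full quasi-support on $\mathbb R^d$. Let $\phi$ be a bounded probability density on $\mathbb R^d$ with compact support and with first order weak derivatives satisfying $|\nabla\phi|\le C'\varrho$ on $\mathbb R^d$ for some constant $C'>0$. Let $r_n\in(0,1]$ with $r_n\downarrow0$, and let $X^n:=X^{r_n}$ be the associated time-changed random walks. Then there are $\gamma'>0$, $c_0>0$ and $C>0$ such that for any $n\ge1$, any $x_0\in\mathbb R^d$ and any $r>0$, if $h$ is bounded and harmonic with respect to $X^n$ in the ball $B(x_0,2r)$, then $$|h(x)-h(y)|\le C\left(\frac{|x-y|\vee c_0r_n}{r}\right)^{\gamma'}\|h\|_\infty\qquad\text{for }x,y\in B(x_0,r).$$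
   Context: Polar sets are sets of zero capacity for standard Brownian motion $W$. Full quasi-support of $\mu$ means: if $A$ is the positive continuous additive functional of $W$ with Revuz measure $\mu$, then $\mathbb P_x(\inf\{s\ge0:A_s>0\}=0)=1$ for all $x$ outside a polar set. For $r>0$ put $\phi_r(x)=r^{-d}\phi(x/r)$ and $\lambda_r(x)=\big(\sigma_\varrho^2r^2\int\phi_r(y-x)\mu(dy)\big)^{-1}$. $X^r$ is the regular step process on $\mathbb R^d$ that waits at $x$ an exponential time of rate $\lambda_r(x)$ and then jumps with density $r^{-d}\varrho((\cdot-x)/r)$. A function $h$ on $\mathbb R^d$ is harmonic in a bounded open set $D$ with respect to a process $Z$ if for every relatively compact (open) subset $D_1$ of $D$, with $\tau_{D_1}$ the exit time of $Z$ from $D_1$, one has $\mathbb E_x[|h(Z_{\tau_{D_1}})|;\tau_{D_1}<\infty]<\infty$ and $h(x)=\mathbb E_x[h(Z_{\tau_{D_1}});\tau_{D_1}<\infty]$ for all $x\in D_1$. $a\vee b=\max\{a,b\}$ and $\|h\|_\infty=\sup_{\mathbb R^d}|h|$. *)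

(* Defs.v *)
From HB Require Import structures.
From mathcomp Require Import all_boot all_order all_algebra.
From mathcomp Require Import all_classical all_reals all_analysis.
From mathcomp Require Import measurable_realfun lra.

Set Implicit Arguments.
Unset Strict Implicit.
Unset Printing Implicit Defensive.

Import Order.TTheory GRing.Theory Num.Theory.
Import numFieldNormedType.Exports.

Local Open Scope classical_set_scope.
Local Open Scope ring_scope.

(* 'rV[R]_d with its Borel sigma-algebra.  The library's norm on row vectors
   is the sup norm: it is used for the topology only, |x| being [enorm x]. *)
Notation euclid R d := (g_sigma_algebraType (@open 'rV[R]_d)).

Section lebesgue_euclid.
Context {R : realType}.

Definition econs d (p : R * euclid R d) : euclid R d.+1 :=
  \row_j oapp ((p.2 : 'rV[R]_d) 0) p.1 (unlift ord0 j).

(* Lebesgue measure on R^d, as an iterated product measure *)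
Fixpoint lebd d : set (euclid R d) -> \bar R :=
  match d with
  | 0%N => \d_(0 : euclid R 0)
  | d'.+1 => pushforward
      (product_measure1 (@lebesgue_measure R) (@lebd d')) (@econs d')
  end.

Arguments lebd d A : clear implicits.

Lemma econs0 d (p : R * euclid R d) : (econs p : 'rV[R]_d.+1) 0 ord0 = p.1.
Proof. by rewrite /econs mxE unlift_none. Qed.

Lemma econsS d (p : R * euclid R d) (i : 'I_d) :
  (econs p : 'rV[R]_d.+1) 0 (lift ord0 i) = (p.2 : 'rV[R]_d) 0 i.
Proof. by rewrite /econs mxE liftK. Qed.

Lemma econs_ball d (c : 'rV[R]_d.+1) e :
  0 < e ->
  @econs d @^-1` (ball c e) =
  ball (c 0 ord0) e `*` ball (\row_i c 0 (lift ord0 i) : 'rV[R]_d) e.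
Proof.
move=> e0; apply/seteqP; split=> -[x v] /=.
  move=> [_ H]; split; first by rewrite /= -[x](econs0 (x, v)); exact: H.
  by split=> // i j; rewrite (ord1 i) mxE -[v]/((x, v).2) -(econsS (x, v)); exact: H.
move=> [Hx [_ Hv]]; split=> // i j; rewrite (ord1 i).
case: (unliftP ord0 j) => [k|] ->; last by rewrite econs0.
by rewrite econsS; have := Hv 0 k; rewrite mxE.
Qed.

Lemma measurable_rV_ball d (c : 'rV[R]_d) e :
  measurable (ball c e : set (euclid R d)).
Proof. by apply: sub_sigma_algebra; exact: ball_open. Qed.

Lemma rV_rat_approx d (x : 'rV[R]_d) e : 0 < e ->
  exists q : 'rV[rat]_d, ball (map_mx ratr q : 'rV[R]_d) e x.
Proof.
move=> e0.
have /choice[q Hq] (i : 'I_d) : exists q : rat, ball (ratr q : R) e (x 0 i).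
  have [q] : exists q, ratr q \in `](x 0 i - e), (x 0 i)[.
    by apply: rat_in_itvoo; rewrite ltrBlDr ltrDl.
  rewrite in_itv/= => /andP[q1 q2]; exists q.
  by rewrite /ball/= ltr_distlC; apply/andP; split; lra.
by exists (\row_i q i); split=> // i j; rewrite (ord1 i) !mxE.
Qed.

Lemma rV_open_cover d (U : set 'rV[R]_d) : open U ->
  U = \bigcup_(p in [set p : 'rV[rat]_d * nat |
         ball (map_mx ratr p.1 : 'rV[R]_d) p.2.+1%:R^-1 `<=` U])
       ball (map_mx ratr p.1 : 'rV[R]_d) p.2.+1%:R^-1.
Proof.
move=> oU; apply/seteqP; split=> [x Ux|x [p /= + xp]]; last by apply.
have /nbhs_ballP[e /= e0 eU] : nbhs x U by exact: open_nbhs_nbhs.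
have [n ne] : exists n : nat, n.+1%:R^-1 < e / 2.
  have := near_infty_natSinv_lt (PosNum (divr_gt0 e0 (ltr0Sn R 1))).
  by move=> [n _ /(_ n (leqnn n))/= ?]; exists n.
have [q qx] := @rV_rat_approx d x n.+1%:R^-1 ltac:(by rewrite invr_gt0).
exists (q, n) => //= y qy; apply: eU; rewrite [e]splitr.
apply: (@ball_triangle _ _ (map_mx ratr q : 'rV[R]_d)).
  by apply/ball_sym; apply: le_ball qx; exact: ltW.
by apply: le_ball qy; exact: ltW.
Qed.

Lemma measurable_econs d : measurable_fun setT (@econs d).
Proof.
apply: measurability => // _ [U oU <-]; rewrite setTI.
rewrite [U](rV_open_cover oU) preimage_bigcup bigcup_mkcond.
apply: countable_bigcupT_measurable => // -[q n]; case: ifPn => _; last first.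
  exact: measurable0.
rewrite econs_ball ?invr_gt0//; apply: measurableX.
  exact: measurable_ball.
exact: measurable_rV_ball.
Qed.

Lemma lebd_sigma_finite d :
  exists2 m : {sigma_finite_measure set (euclid R d) -> \bar R},
    lebd d = m & forall k : nat, (m (ball (0 : 'rV[R]_d) k.+1%:R)%R < +oo)%E.
Proof.
elim: d => [|d [m lm mfin]].
  exists \d_(0 : euclid R 0) => // k; rewrite /= diracE; case: (_ \in _); exact: ltry.
pose p : {measure set (euclid R d.+1) -> \bar R} :=
  measure_function_pushforward__canonical__measure_function_Measure
    (product_measure1 (@lebesgue_measure R) m) (@measurable_econs d).
have pball (k : nat) : (p (ball (0 : 'rV[R]_d.+1) k.+1%:R)%R < +oo)%E.
  rewrite /p/= /pushforward econs_ball//.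
  have -> : (\row_i (0 : 'rV[R]_d.+1) 0 (lift ord0 i) : 'rV[R]_d) = 0.
    by apply/rowP => i; rewrite !mxE.
  rewrite product_measure1E; [|exact: measurable_ball|exact: measurable_rV_ball].
  rewrite mxE [X in (X * _)%E]lebesgue_measure_ball//; apply: lte_mul_pinfty => //; exact: mfin.
have psf : sigma_finite setT p.
  exists (fun k => ball (0 : 'rV[R]_d.+1) k.+1%:R); last first.
    by move=> k; split; [exact: measurable_rV_ball|exact: pball].
  apply/esym/seteqP; split=> // x _.
  exists (Num.Def.trunc `|x|) => //; rewrite -ball_normE/= sub0r normrN.
  by rewrite truncnS_gt.
pose q : {sigma_finite_measure set (euclid R d.+1) -> \bar R} :=
  HB.pack (p : set _ -> \bar R) (Measure.class p) (Measure_isSigmaFinite.Build _ _ _ p psf).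
by exists q => //=; rewrite lm.
Qed.

Let lebd0 d : lebd d set0 = 0%E.
Proof. by have [m -> _] := lebd_sigma_finite d; rewrite measure0. Qed.

Let lebd_ge0 d A : (0 <= lebd d A)%E.
Proof. by have [m -> _] := lebd_sigma_finite d; exact: measure_ge0. Qed.

Let lebd_semi_sigma_additive d : semi_sigma_additive (lebd d).
Proof.
by have [m -> _] := lebd_sigma_finite d; exact: measure_semi_sigma_additive.
Qed.

HB.instance Definition _ d := isMeasure.Build _ _ _ (lebd d)
  (lebd0 d) (@lebd_ge0 d) (@lebd_semi_sigma_additive d).

Let sigma_finite_lebd d : sigma_finite setT (lebd d).
Proof. by have [m -> _] := lebd_sigma_finite d; exact: sigma_finiteT. Qed.

HB.instance Definition _ d := Measure_isSigmaFinite.Build _ _ _ (lebd d)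
  (sigma_finite_lebd d).

End lebesgue_euclid.
Arguments lebd : clear implicits.

Section euclidean_analysis.
Context {R : realType} {d : nat}.
Implicit Types (f g : euclid R d -> R) (A B D : set (euclid R d)).

Definition ecoord (x : euclid R d) (i : 'I_d) : R := (x : 'rV[R]_d) 0 i.

Definition enorm (x : euclid R d) : R := Num.sqrt (\sum_i ecoord x i ^+ 2).

Definition eball (x : euclid R d) (r : R) : set (euclid R d) :=
  [set y | enorm (y - x) < r].

Definition compactly_supported f := compact (closure [set x | f x != 0]).

(* f_r(x) = r^{-d} f(x / r) *)
Definition dilate (r : R) f : euclid R d -> R :=
  fun x => r ^- d * f (r^-1 *: x).

Definition is_density f :=
  [/\ measurable_fun setT f, forall x, 0 <= f x &
      (\int[lebd R d]_x (f x)%:E = 1)%E].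

Definition locally_integrable_euclid f :=
  measurable_fun setT f /\
  forall K, compact K -> (lebd R d).-integrable K (EFin \o f).

Definition partial (i : 'I_d) (f : 'rV[R]_d -> R) : 'rV[R]_d -> R :=
  fun x => 'D_(delta_mx 0 i) f x.

(* smoothness: all iterated partial derivatives exist and are continuous *)
Definition smooth (f : 'rV[R]_d -> R) :=
  forall s : seq 'I_d, continuous (foldr partial f s) /\
    forall (i : 'I_d) x, derivable (foldr partial f s) x (delta_mx 0 i).

Definition test_function f := smooth f /\ compactly_supported f.

Definition weak_gradient f (G : 'I_d -> euclid R d -> R) :=
  [/\ locally_integrable_euclid f,
      forall i, locally_integrable_euclid (G i) &
      forall i psi, test_function psi ->
        \int[lebd R d]_x (f x * partial i psi x) =
        - \int[lebd R d]_x (G i x * psi x)].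

(* 1-capacity of Brownian motion, i.e. of its Dirichlet form
   E(u, u) = 1/2 \int |grad u|^2 on H^1(R^d), by way of open sets: the
   infimum over u in H^1 with u >= 1 a.e. on an open O containing A of
   E(u, u) + \int u^2.  If u is not in H^1 the latter is +oo. *)
Definition capacity A : \bar R :=
  ereal_inf [set e | exists O u G,
    [/\ open O, A `<=` O, weak_gradient u G,
        {ae lebd R d, forall x, O x -> 1 <= u x} &
        e = (\int[lebd R d]_x
               (2^-1 * (\sum_i G i x ^+ 2) + u x ^+ 2)%:E)%E]].

Definition polar A := capacity A = 0%E.

Definition radon (mu : {measure set (euclid R d) -> \bar R}) :=
  forall K : set (euclid R d), compact K -> (mu K < +oo)%E.

Definition charges_no_polar (mu : {measure set (euclid R d) -> \bar R}) :=
  forall N : set (euclid R d), measurable N -> polar N -> mu N = 0%E.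

End euclidean_analysis.

Section brownian_motion.
Context {R : realType} {d : nat} {dW : measure_display}
  {Omega : measurableType dW}.
Variables (P : euclid R d -> probability Omega R)
  (W : R -> Omega -> euclid R d) (theta : R -> Omega -> Omega).

Definition heat_kernel (t : R) (x : euclid R d) : R :=
  (Num.sqrt (2 * pi * t)) ^- d * expR (- (enorm x ^+ 2 / (2 * t))).

(* [:: (t1, B1); ...; (tk, Bk)] encodes the event
   W_{t1} \in B1, W_{t1 + t2} \in B2, ..., here started from time t0 *)
Fixpoint path_event (t0 : R) (s : seq (R * set (euclid R d))) : set Omega :=
  match s with
  | [::] => setT
  | (t, B) :: s' => W (t0 + t) @^-1` B `&` path_event (t0 + t) s'
  end.

Fixpoint gaussian_fdd (s : seq (R * set (euclid R d))) (x : euclid R d)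
    : \bar R :=
  match s with
  | [::] => 1%E
  | (t, B) :: s' =>
      (\int[lebd R d]_(y in B) ((heat_kernel t (y - x))%:E
                                * gaussian_fdd s' y))%E
  end.

(* standard Brownian motion as a Markov process with shift operators; time
   is R, only times t >= 0 being relevant *)
Record brownian_motion : Prop := BrownianMotion {
  bm_measurable : forall t, 0 <= t -> measurable_fun setT (W t);
  bm_continuous : forall w,
    {within `[0, +oo[, continuous (fun t => W t w : 'rV[R]_d)};
  bm_shift : forall s t w, 0 <= s -> 0 <= t -> W s (theta t w) = W (t + s) w;
  bm_start : forall x, P x (W 0 @^-1` [set x]) = 1%E;
  bm_fdd : forall x s,
    (forall p, List.In p s -> 0 < p.1 /\ measurable p.2) ->
    P x (path_event 0 s) = gaussian_fdd s x }.

(* sigma (W_s : s in I), then its completion (within sigma (W_s : s >= 0))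
   with respect to all P_nu = \int P_x nu(dx), nu an initial distribution *)
Definition sigmaW (I : set R) : set (set Omega) :=
  <<s \bigcup_(s in I) preimage_set_system setT (W s) measurable >>.

Definition completed_sigmaW (I : set R) : set (set Omega) :=
  [set G | forall nu : probability (euclid R d) R, exists B N,
    [/\ sigmaW I B, sigmaW `[0, +oo[ N,
        (\int[nu]_x P x N = 0)%E & (G `\` B) `|` (B `\` G) `<=` N]].

(* positive continuous additive functional, with defining set Lambda and
   exceptional set N; without loss of generality every path of A is a
   [cumulative] function *)
Record pcaf (A : Omega -> cumulative R R) : Prop := Pcaf {
  pcaf_adapted : forall t (B : set R), 0 <= t -> measurable B ->
    completed_sigmaW `[0, t] [set w | B (A w t)];
  pcaf_additive : exists (Lambda : set Omega) (N : set (euclid R d)),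
    [/\ completed_sigmaW `[0, +oo[ Lambda,
        polar N,
        forall x, ~ N x -> {ae P x, forall w, Lambda w},
        forall t w, 0 <= t -> Lambda w -> Lambda (theta t w) &
        forall w, Lambda w ->
          [/\ continuous (A w), forall t, t <= 0 -> A w t = 0 &
              forall s t, 0 <= s -> 0 <= t ->
                A w (t + s) = A w t + A (theta t w) s]] }.

(* \int f dmu = lim_{t -> 0+} t^-1 \int E_x[\int_0^t f(W_s) dA_s] dx,
   Lebesgue measure being the symmetrizing measure of W *)
Definition revuz_measure (A : Omega -> cumulative R R)
    (mu : {measure set (euclid R d) -> \bar R}) :=
  forall f : euclid R d -> R, measurable_fun setT f -> (forall x, 0 <= f x) ->
    ((t^-1)%:E * \int[lebd R d]_x \int[P x]_w
       \int[lebesgue_stieltjes_measure (A w)]_(s in [set s | (0 < s <= t)%R]) (f (W s w))%:E)%E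
    @[t --> (0 : R)^'+] --> (\int[mu]_x (f x)%:E)%E.

Definition full_quasi_support (mu : {measure set (euclid R d) -> \bar R}) :=
  forall A : Omega -> cumulative R R, pcaf A -> revuz_measure A mu ->
    exists2 N : set (euclid R d), polar N &
      forall x, ~ N x ->
        {ae P x, forall w, ereal_inf [set s%:E | s in
                             [set s : R | 0 <= s /\ 0 < A w s]] = 0%E}.

End brownian_motion.

(* Processes may have a finite lifetime, [None] being the cemetery. *)
Section processes.
Context {R : realType} {d : nat} {dX : measure_display}
  {Omega : measurableType dX}.
Variables (P : euclid R d -> probability Omega R)
  (X : R -> Omega -> option (euclid R d)).

Section step_process.
Variables (lambda : euclid R d -> R) (q : euclid R d -> euclid R d -> R).

(* [:: (B0, t0); (B1, t1); ...] encodes the event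
   Y_0 \in B0, T_0 > t0, Y_1 \in B1, T_1 > t1, ..., here started from index k *)
Fixpoint step_event (Y : nat -> Omega -> euclid R d) (T : nat -> Omega -> R)
    (k : nat) (s : seq (set (euclid R d) * R)) : set Omega :=
  match s with
  | [::] => setT
  | (B, t) :: s' =>
      [set w | B (Y k w) /\ t < T k w] `&` step_event Y T k.+1 s'
  end.

Fixpoint step_law (s : seq (set (euclid R d) * R)) (x : euclid R d) : \bar R :=
  match s with
  | [::] => 1%E
  | (B, t) :: s' =>
      ((\1_B x * expR (- (lambda x * t)))%:E *
       \int[lebd R d]_y ((q x y)%:E * step_law s' y))%E
  end.

(* X visits successively Y_0, Y_1, ..., staying for a time T_k at Y_k; at x
   the waiting time is exponential of rate lambda x and then the position is
   renewed with density q x.  Rates of a step process lie in (0, oo); X is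
   killed at the (possibly infinite) time \sum_k T_k. *)
Definition regular_step_process :=
  (forall x, 0 < lambda x) /\
  exists (Y : nat -> Omega -> euclid R d) (T : nat -> Omega -> R),
    [/\ forall k, measurable_fun setT (Y k) /\ measurable_fun setT (T k),
        forall k w, 0 < T k w,
        forall x s, (forall p, List.In p s -> measurable p.1 /\ 0 <= p.2) ->
          P x (step_event Y T 0 s) = step_law s x,
        forall k t w, \sum_(i < k) T i w <= t < \sum_(i < k.+1) T i w ->
          X t w = Some (Y k w) &
        forall t w, (forall k, \sum_(i < k) T i w <= t) -> X t w = None].

End step_process.

Definition exit_time (D : set (euclid R d)) (w : Omega) : \bar R :=
  ereal_inf [set t%:E | t in
    [set t : R | 0 <= t /\ ~ exists2 y, X t w = Some y & D y]].

(* h extended by 0 at the cemetery *)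
Definition exit_value (h : euclid R d -> R) (D : set (euclid R d)) (w : Omega)
  : R := oapp h 0 (X (fine (exit_time D w)) w).

(* h is required to be Borel, so that the expectations are meaningful *)
Definition harmonic_in (h : euclid R d -> R) (D : set (euclid R d)) :=
  measurable_fun setT h /\
  forall D1 : set (euclid R d), open D1 -> compact (closure D1) ->
    closure D1 `<=` D -> forall x, D1 x ->
    (\int[P x]_(w in [set w | exit_time D1 w < +oo])
       `|exit_value h D1 w|%:E < +oo /\
     (h x)%:E = \int[P x]_(w in [set w | exit_time D1 w < +oo])
       (exit_value h D1 w)%:E)%E.

End processes.

Section time_changed_walk.
Context {R : realType} {d : nat}.

Definition walk_rate (sigma : R) (phi : euclid R d -> R)
    (mu : {measure set (euclid R d) -> \bar R}) (r : R) (x : euclid R d) : R :=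
  (sigma ^+ 2 * r ^+ 2 * \int[mu]_y dilate r phi (y - x))^-1.

(* the process X^r *)
Definition time_changed_walk (dX : measure_display) (Omega : measurableType dX)
    (rho : euclid R d -> R) (sigma : R) (phi : euclid R d -> R)
    (mu : {measure set (euclid R d) -> \bar R}) (r : R)
    (P : euclid R d -> probability Omega R)
    (X : R -> Omega -> option (euclid R d)) :=
  regular_step_process P X (walk_rate sigma phi mu r)
    (fun x y => dilate r rho (y - x)).

Definition sup_norm (h : euclid R d -> R) : R := sup (range (fun z => `|h z|)).

End time_changed_walk.

(* Main.v *)
Require Import Defs.
From HB Require Import structures.
From mathcomp Require Import all_boot all_order all_algebra.
From mathcomp Require Import all_classical all_reals all_analysis.
From mathcomp Require Import measurable_realfun ring lra.

Set Implicit Arguments.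
Unset Strict Implicit.
Unset Printing Implicit Defensive.

Import Order.TTheory GRing.Theory Num.Theory.
Import numFieldNormedType.Exports.

Local Open Scope classical_set_scope.
Local Open Scope ring_scope.

(* Exiting a ball that shrinks to x happens at the first jump with probability
   tending to 1, so the harmonic function h satisfies the one-step mean value
   property h = P h in B(x0, 2r), where P is the average against rho dilated by
   r_n; the holding times, hence mu and phi, play no further role.
   Two estimates are then combined.
   (1) |h - P^k h| <= C |h|_oo k r_n^2 / r^2 in B(x0, r): by induction on k,
   2 |h|_oo (|y - x|^2 + k d sigma^2 r_n^2) / r^2 dominates |h - P^k h| (y), since
   P adds exactly d sigma^2 r_n^2 to |. - x|^2 and the bound is trivial at
   distance >= r from x.
   (2) |P^k h (x) - P^k h (x + j z)| <= C |h|_oo j / sqrt k for |z| <= a r_n: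
   rho and its translates by small vectors overlap, so two walks at distance
   j z can be coupled with their difference a lazy simple random walk on the
   multiples of z, killed at 0.
   With S = max(|x - y|, r_n) / r and k of order S (r / r_n)^2, both errors
   are of order sqrt S. *)

(** * Measurability in Euclidean space *)

(** Nothing makes [rho] continuous or bounded below on a ball, so one step of the walk has no
    quantitative modulus of continuity; what is available is some mass shared by [rho] and its
    translates by vectors shorter than [a]. This gives regularity only above the scale [r_n], whence
    the maximum with [c0 * rn n]. The mean value property holds only inside the ball, while the
    coupling needs an operator on the whole space. So [P^k h] is formed with the globally bounded
    [h], and (1) is a comparison argument that takes the place of an exit time estimate. Likewise
    (2) constructs no joint process: the coupling is a recursion on bounds [b j] for differences of
    values at points [j z] apart. With [T = sqrt k * r_n / r], the two errors are of order [T^2] and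
    [S / T]. The choice [T = sqrt S] makes the second one [sqrt S] and the first one the smaller
    [S]; hence the exponent 1/2. Balancing them by [T = S^(1/3)] would give 2/3. *)

Section measurability.
Context {R : realType}.

Lemma measurable_ecoord d (i : 'I_d) :
  measurable_fun setT (fun x : euclid R d => ecoord x i).
Proof.
apply: (measurability _ (RGenOpens.measurableE R)) => _ [_ [a [b ->] <-]].
rewrite setTI; apply: sub_sigma_algebra; apply: open_comp.
  by move=> x _; exact: coord_continuous.
exact: interval_open.
Qed.

(** Balls of the sup norm are finite intersections of coordinate slabs, and [rV_open_cover] writes
    an open set as a countable union of rational balls. *)
Lemma measurable_fun_euclid d dT (T : measurableType dT) (F : T -> euclid R d) :
  (forall i, measurable_fun setT (fun t => ecoord (F t) i)) ->
  measurable_fun setT F.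
Proof.
move=> mF; apply: measurability => // _ [U oU <-]; rewrite setTI.
rewrite [U](rV_open_cover oU) preimage_bigcup bigcup_mkcond.
apply: countable_bigcupT_measurable => // -[q n]; case: ifPn => _; last first.
  exact: measurable0.
set c := map_mx _ _; set e := _^-1.
have e0 : 0 < e by rewrite invr_gt0.
rewrite (_ : F @^-1` ball c e =
    \bigcap_(i in [set: 'I_d]) (fun t => ecoord (F t) i) @^-1` ball (c 0 i) e).
  apply: fin_bigcap_measurable => // i _.
  by rewrite -[X in measurable X]setTI; apply: mF => //; exact: measurable_ball.
apply/seteqP; split=> [t /= [_ H] i _|t H]; first exact: H.
by split=> // i j; rewrite (ord1 i); exact: (H j I).
Qed.

Lemma measurable_affine d (a : R) (b : euclid R d) :
  measurable_fun setT (fun x : euclid R d => a *: (x : 'rV[R]_d) + b : euclid R d).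
Proof.
apply: measurable_fun_euclid => i.
rewrite (_ : (fun t => _) = (fun t : euclid R d => a * ecoord t i + ecoord b i)).
  apply: measurable_funD => //; apply: measurable_funM => //.
  exact: measurable_ecoord.
by apply/funext => t; rewrite /ecoord !mxE.
Qed.

Lemma measurable_eadd d : measurable_fun setT
  (fun p : euclid R d * euclid R d => (p.1 : 'rV[R]_d) + p.2 : euclid R d).
Proof.
apply: measurable_fun_euclid => i.
rewrite (_ : (fun t => _) = (fun t : euclid R d * euclid R d => ecoord t.1 i + ecoord t.2 i)).
  by apply: measurable_funD; apply: measurableT_comp (measurable_ecoord i) _.
by apply/funext => t; rewrite /ecoord !mxE.
Qed.

Lemma measurable_enorm2 d :
  measurable_fun setT (fun x : euclid R d => enorm x ^+ 2).
Proof.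
rewrite (_ : (fun t => _) = (fun t : euclid R d => \sum_i ecoord t i ^+ 2)).
  apply: measurable_sum => i; apply: measurable_funX; exact: measurable_ecoord.
by apply/funext => t; rewrite /enorm sqr_sqrtr// sumr_ge0// => i _; rewrite sqr_ge0.
Qed.

End measurability.

(** * Affine changes of variables *)

Section change_of_variables.
Context {R : realType}.
Local Notation leb := (@lebesgue_measure R).

Let measurable_affineR (a b : R) :
  measurable_fun setT (fun x : measurableTypeR R => a * x + b : measurableTypeR R).
Proof. by apply: measurable_funD => //; apply: measurable_funM. Qed.

Let gt0_integral_affineR (a b : R) (f : R -> \bar R) :
  0 < a -> measurable_fun setT f -> (forall x, 0 <= f x)%E ->
  (\int[leb]_x f x = a%:E * \int[leb]_x f (a * x + b)%R)%E.
Proof.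
move=> a0 mf f0.
pose m : {measure set (measurableTypeR R) -> \bar R} :=
  mscale (NngNum (ltW a0)) (measure_function_pushforward__canonical__measure_function_Measure
    leb (measurable_affineR a b)).
(* Lebesgue measure is [a] times its image under the affine map, as both agree on half-open
   intervals. *)
rewrite (@eq_measure_integral _ _ _ setT m) => [|A mA _]; last first.
  apply: lebesgue_measure_unique => // _ [[u v]] _ <-.
  rewrite /m/= /mscale/= /pushforward/=.
  rewrite (_ : _ @^-1` _ = `](u - b) / a, (v - b) / a]%classic); last first.
    apply/seteqP; split=> x /=; rewrite !in_itv/= ltr_pdivrMr// ler_pdivlMr//;
    by move=> /andP[]; rewrite ltrBlDr lerBrDr mulrC => -> ->.
  rewrite !lebesgue_measure_itv/= !lte_fin ltr_pM2r ?invr_gt0// ltrD2r.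
  case: ifPn => _; last by rewrite mule0.
  rewrite -!EFinB -EFinM; congr EFin; field; exact: lt0r_neq0.
rewrite /m ge0_integral_mscale//=; congr *%E.
by rewrite ge0_integral_pushforward.
Qed.

Lemma ge0_integral_affineR (a b : R) (f : R -> \bar R) :
  a != 0 -> measurable_fun setT f -> (forall x, 0 <= f x)%E ->
  (\int[leb]_x f x = `|a|%:E * \int[leb]_x f (a * x + b)%R)%E.
Proof.
move=> a0 mf f0; have [a_gt0|] := ltP 0 a.
  by rewrite gtr0_norm//; exact: gt0_integral_affineR.
rewrite le_eqVlt (negbTE a0)/= => a_lt0; rewrite ltr0_norm//.
rewrite (@gt0_integral_affineR (- a) b)// ?oppr_gt0//; congr *%E.
transitivity (\int[pushforward leb (-%R : _ -> measurableTypeR R)]_x f (- a * x + b)%R)%E.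
  by apply: eq_measure_integral => //= A mA _; exact/esym/lebesgue_measureN.
rewrite ge0_integral_pushforward//=.
  by apply: eq_integral => x _ /=; rewrite mulrNN.
by apply: measurableT_comp => //; exact: measurable_affineR.
Qed.

Let integral_econs d (f : euclid R d.+1 -> \bar R) :
  measurable_fun setT f -> (forall x, 0 <= f x)%E ->
  (\int[lebd R d.+1]_x f x =
   \int[leb]_t \int[lebd R d]_v f (econs (t, v)))%E.
Proof.
move=> mf f0.
rewrite -[LHS]/(\int[pushforward (product_measure1 leb (lebd R d)) (@econs R d)]_x f x)%E.
rewrite ge0_integral_pushforward//; last exact: measurable_econs.
rewrite preimage_setT fubini_tonelli1//; last by move=> x; exact: f0.
by apply: measurableT_comp => //; exact: measurable_econs.
Qed.

(** The map acts on each coordinate separately, so Tonelli peels off the first coordinate and each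
    one contributes a factor [|a|]. *)
Lemma ge0_integral_affine d (a : R) (b : euclid R d) (f : euclid R d -> \bar R) :
  a != 0 -> measurable_fun setT f -> (forall x, 0 <= f x)%E ->
  (\int[lebd R d]_x f x =
   (`|a| ^+ d)%:E * \int[lebd R d]_x f (a *: (x : 'rV[R]_d) + b)%R)%E.
Proof.
move=> a0; elim: d => [|d IH] in b f * => mf f0.
  rewrite expr0 mul1e; apply: eq_integral => x _; congr f.
  by apply/rowP => i; case: i.
have mfab := measurableT_comp mf (measurable_affine a b).
rewrite integral_econs// (integral_econs mfab)//; last by move=> x; exact: f0.
pose b' : euclid R d := \row_i (b : 'rV[R]_d.+1) 0 (lift ord0 i).
have E t v : f (a *: (econs (t, v) : 'rV[R]_d.+1) + b) =
   f (econs (a * t + (b : 'rV[R]_d.+1) 0 ord0, a *: (v : 'rV[R]_d) + b' : euclid R d)).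
  congr f; apply/rowP => i; rewrite mxE [in LHS]mxE.
  case: (unliftP ord0 i) => [j|] ->.
    by rewrite !econsS /= !mxE.
  by rewrite !econs0.
pose g t := (\int[lebd R d]_v f (econs (t, v)))%E.
have mg : measurable_fun setT g.
  apply: (@measurable_fun_fubini_tonelli_F _ _ _ _ _ (lebd R d) (fun p => f (econs p))) => //.
  by apply: measurableT_comp => //; exact: measurable_econs.
have g0 t : (0 <= g t)%E by apply: integral_ge0.
rewrite (ge0_integral_affineR ((b : 'rV[R]_d.+1) 0 ord0) a0)//.
rewrite exprS EFinM -muleA; congr *%E.
rewrite -ge0_integralZl//; last 2 first.
- apply: (@measurable_fun_fubini_tonelli_F _ _ _ _ _ (lebd R d)
    (fun p => f (a *: (econs p : 'rV[R]_d.+1) + b))) => //.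
  exact: measurableT_comp mfab (@measurable_econs R d).
- by move=> x _; apply: integral_ge0 => v _; exact: f0.
apply: eq_integral => t _.
rewrite (IH b')//; last first.
  apply: (measurableT_comp mf); apply: (measurableT_comp (@measurable_econs R d)).
  exact: measurable_pair1.
by congr *%E; apply: eq_integral => v _; exact: esym (E _ _).
Qed.

Lemma integral_shift d (b : euclid R d) (f : euclid R d -> \bar R) :
  measurable_fun setT f ->
  (\int[lebd R d]_x f ((x : 'rV[R]_d) + b)%R = \int[lebd R d]_x f x)%E.
Proof.
move=> mf; rewrite [LHS]integralE [RHS]integralE.
have H (g : euclid R d -> \bar R) : measurable_fun setT g -> (forall x, 0 <= g x)%E ->
    (\int[lebd R d]_x g ((x : 'rV[R]_d) + b)%R = \int[lebd R d]_x g x)%E.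
  move=> mg g0; rewrite (@ge0_integral_affine _ 1 b g)//.
  rewrite normr1 expr1n mul1e; apply: eq_integral => x _; by rewrite scale1r.
congr (_ - _)%E.
- rewrite -[RHS](H f^\+%E (measurable_funepos mf) (funepos_ge0 f)).
  by apply: eq_integral => x _; rewrite !funeposE.
- rewrite -[RHS](H f^\-%E (measurable_funeneg mf) (funeneg_ge0 f)).
  by apply: eq_integral => x _; rewrite !funenegE.
Qed.

Lemma ge0_integral_reflect d (f : euclid R d -> \bar R) :
  measurable_fun setT f -> (forall x, 0 <= f x)%E ->
  (\int[lebd R d]_x f (- (x : 'rV[R]_d))%R = \int[lebd R d]_x f x)%E.
Proof.
move=> mf f0; rewrite (@ge0_integral_affine _ (-1) (0 : 'rV[R]_d) f)//.
  by rewrite normrN1 expr1n mul1e; apply: eq_integral => x _; rewrite addr0 scaleN1r.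
Qed.

End change_of_variables.

(** * Regularity and overlap of translates *)

Section regularity.
Context {R : realType} {d : nat}.
Variable m : {measure set (euclid R d) -> \bar R}.
Hypothesis mfin : (m setT < +oo)%E.

Lemma open_emeasurable (U : set 'rV[R]_d) : open U -> measurable (U : set (euclid R d)).
Proof. by move=> oU; exact: sub_sigma_algebra. Qed.

Lemma closed_emeasurable (C : set 'rV[R]_d) : closed C -> measurable (C : set (euclid R d)).
Proof.
by move=> cC; rewrite -(setCK C); apply: measurableC; apply: open_emeasurable; exact: closed_openC.
Qed.

Lemma nonincreasing_small (F : nat -> set (euclid R d)) (e : R) :
  (forall n, measurable (F n)) -> nonincreasing_seq F -> \bigcap_n F n = set0 ->
  0 < e -> exists n, (m (F n) < e%:E)%E.
Proof.
move=> mF ndF F0 e0.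
have F0fin : (m (F 0%N) < +oo)%E.
  by apply: le_lt_trans mfin; apply: le_measure => //; rewrite inE.
have mcap : measurable (\bigcap_n F n) by rewrite F0.
have := nonincreasing_cvg_mu F0fin mF mcap ndF.
rewrite F0 measure0 => mF0.
have : \forall n \near \oo, (m (F n) < e%:E)%E.
  by apply: (mF0 [set y | (y < e%:E)%E]); apply: open_ereal_lt'; rewrite lte_fin.
by case=> N _ HN; exists N; apply: HN => /=.
Qed.

Definition thickening (C : set 'rV[R]_d) (e : R) : set 'rV[R]_d :=
  \bigcup_(x in C) ball x e.

Lemma open_thickening C e : 0 < e -> open (thickening C e).
Proof. by move=> e0; apply: bigcup_open => x _; exact: ball_open. Qed.

(** A closed set is the intersection of its thickenings of radius [1/(n+1)], so the excess decreases
    to the empty set; continuity from above applies since [m] is finite. *)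
Lemma thickening_small (C : set 'rV[R]_d) (e : R) : closed C -> 0 < e ->
  exists2 a : R, 0 < a & (m (thickening C a `\` C)%classic < e%:E)%E.
Proof.
move=> cC e0.
have [|||n] := @nonincreasing_small
  (fun n => thickening C n.+1%:R^-1 `\` C : set (euclid R d)) e _ _ _ e0.
- move=> n; apply: measurableD; last exact: closed_emeasurable.
  by apply: open_emeasurable; apply: open_thickening; rewrite invr_gt0.
- move=> p q pq; apply/subsetPset => x [[y Cy yx] nCx]; split => //.
  exists y => //; apply: le_ball yx; by rewrite lef_pV2 ?posrE// ler_nat.
- apply/seteqP; split=> // x H; have [_ nCx] := H 0%N I.
  apply: nCx; apply: cC => B /nbhs_ballP[r /= r0 rB].
  have [n _ nr] := near_infty_natSinv_lt (PosNum r0).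
  have [[y Cy yx] _] := H n I; exists y; split=> //; apply: rB.
  apply/ball_sym; apply: le_ball yx; apply: ltW; exact: (nr n (leqnn n)).
by move=> H; exists n.+1%:R^-1 => //; rewrite invr_gt0.
Qed.

(** Good-sets argument: the sets that can be squeezed between a closed and an open set form a
    sigma-algebra containing the open sets. *)
Lemma closed_open_regularity (A : set (euclid R d)) : measurable A ->
  forall e : R, 0 < e -> exists F O : set 'rV[R]_d,
    [/\ closed F, open O, F `<=` A, A `<=` O & (m (O `\` F)%classic < e%:E)%E].
Proof.
pose reg := [set A : set (euclid R d) | forall e : R, 0 < e -> exists F O : set 'rV[R]_d,
    [/\ closed F, open O, F `<=` A, A `<=` O & (m (O `\` F)%classic < e%:E)%E]].
suff : <<s @open 'rV[R]_d >> `<=` reg by exact.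
clear A; apply: smallest_sub; last first.
  move=> U oU e e0.
  have [a a0 ae] := @thickening_small (~` U) e (open_closedC oU) e0.
  exists (~` thickening (~` U) a), U; split=> //.
  - by apply: open_closedC; exact: open_thickening.
  - by move=> x nx; apply: contrapT => nUx; apply: nx; exists x => //; exact: ballxx.
  - apply: le_lt_trans ae; apply: le_measure; rewrite ?inE.
    + apply: measurableD; first exact: open_emeasurable.
      by apply: closed_emeasurable; apply: open_closedC; exact: open_thickening.
    + apply: measurableD; first by apply: open_emeasurable; exact: open_thickening.
      by apply: closed_emeasurable; exact: open_closedC.
    + by move=> x [Ux /contrapT nx]; split => //; exact.
split.
- move=> e e0; exists set0, set0; split=> //; first exact: closed0.
  by rewrite setD0 measure0.
- move=> A regA e /regA[F [ O [cF oO FA AO Oe]]].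
  exists (~` O), (~` F); split.
  + exact: open_closedC.
  + exact: closed_openC.
  + by rewrite setTD; exact: subsetC.
  + by rewrite setTD; exact: subsetC.
  + by rewrite setDE setCK setIC -setDE.
- move=> A regA e e0.
  have e20 : 0 < e / 2 by rewrite divr_gt0.
  have /choice[FO HFO] : forall i, exists FO : set 'rV[R]_d * set 'rV[R]_d,
    [/\ closed FO.1, open FO.2, FO.1 `<=` A i, A i `<=` FO.2 &
       (m (FO.2 `\` FO.1)%classic < (e / 2 / (2 ^ i.+1)%:R)%:E)%E].
    move=> i; have [|F [ O H]] := regA i (e / 2 / (2 ^ i.+1)%:R).
      by rewrite divr_gt0// ltr0n expn_gt0.
    by exists (F, O).
  pose F i := (FO i).1; pose O i := (FO i).2.
  have cF i : closed (F i) by case: (HFO i).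
  have oO i : open (O i) by case: (HFO i).
  have mF i : measurable (F i : set (euclid R d)) by exact: closed_emeasurable.
  have mO i : measurable (O i : set (euclid R d)) by exact: open_emeasurable.
  have m1 : (m (\bigcup_i O i `\` \bigcup_i F i)%classic <= (e / 2)%:E)%E.
    apply: le_trans (epsilon_trick0 xpredT (ltW e20)).
    apply: (@le_trans _ _ (\sum_(i <oo) m (O i `\` F i)%classic)%E).
      apply: measure_sigma_subadditive.
      - by move=> i; exact: measurableD.
      - by apply: measurableD; exact: bigcupT_measurable.
      - by move=> x [[i _ Oix] nF]; exists i => //; split=> // Fix; apply: nF; exists i.
    by apply: lee_nneseries => // i _; case: (HFO i) => _ _ _ _ /ltW.
  (* A countable union of closed sets need not be closed: a finite subunion is kept, and the second
     half of [e] pays for the rest. *)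
  pose FN n : set (euclid R d) := \bigcup_(i < n) F i.
  have cFN n : closed (FN n : set 'rV[R]_d).
    by apply: closed_bigcup => //; exact: finite_II.
  have [|||n mn] := @nonincreasing_small (fun n => \bigcup_i F i `\` FN n) (e / 2) _ _ _ e20.
  + move=> n; apply: measurableD; first exact: bigcupT_measurable.
    exact: closed_emeasurable.
  + move=> p q pq; apply/subsetPset => x [Fx nx]; split=> // -[i /= ip Fix]; apply: nx.
    by exists i => //=; exact: leq_trans pq.
  + apply/seteqP; split=> // x H; have [[i _ Fix] _] := H 0%N I.
    by have [_] := H i.+1 I; apply; exists i => /=.
  exists (FN n), (\bigcup_i O i); split=> //.
  + exact: bigcup_open.
  + move=> x [i _ Fix]; exists i => //; by case: (HFO i) => _ _ + _ _; apply.
  + by move=> x [i _ Aix]; exists i => //; case: (HFO i) => _ _ _ + _; apply.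
  + apply: (@le_lt_trans _ _ (m (\bigcup_i O i `\` \bigcup_i F i) + m (\bigcup_i F i `\` FN n))%E).
      apply: le_trans (measureU2 _ _ _); last 2 first.
      - by apply: measurableD; exact: bigcupT_measurable.
      - apply: measurableD; first exact: bigcupT_measurable.
        exact: closed_emeasurable.
      apply: le_measure; rewrite ?inE.
      - apply: measurableD; first exact: bigcupT_measurable.
        exact: closed_emeasurable.
      - apply: measurableU; apply: measurableD; try exact: bigcupT_measurable.
        exact: closed_emeasurable.
      - move=> x [Ox nFx]; have [Fx|nF] := pselect ((\bigcup_i F i) x).
          by right.
        by left.
    rewrite [e]splitr EFinD; apply: lee_ltD => //.
    rewrite ge0_fin_numE//; apply: le_lt_trans m1 _; exact: ltry.
Qed.

End regularity.

(** * Mass shared by a function and its small translates *)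

Section overlap.
Context {R : realType} {d : nat}.
Local Notation leb := (lebd R d).

Lemma lebd_ball_fin (k : nat) : (leb (ball (0 : 'rV[R]_d) k.+1%:R)%R < +oo)%E.
Proof. by have [m -> ] := @lebd_sigma_finite R d. Qed.

Definition shift_set (z : 'rV[R]_d) (A : set (euclid R d)) : set (euclid R d) :=
  [set x : euclid R d | A ((x : 'rV[R]_d) - z)].

Lemma measurable_shift_fun (z : 'rV[R]_d) :
  measurable_fun setT (fun x : euclid R d => (x : 'rV[R]_d) - z : euclid R d).
Proof.
rewrite (_ : (fun x => _) = (fun x : euclid R d => 1 *: (x : 'rV[R]_d) + (- z) : euclid R d)).
  exact: measurable_affine.
by apply/funext => x; rewrite scale1r.
Qed.

Lemma measurable_shift_set z A : measurable A -> measurable (shift_set z A).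
Proof. by move=> mA; rewrite -[X in measurable X]setTI; apply: measurable_shift_fun. Qed.

Lemma lebd_shift z A : measurable A -> leb (shift_set z A) = leb A.
Proof.
move=> mA; have mzA := measurable_shift_set z mA.
rewrite -[LHS]mul1e -[RHS]mul1e -!integral_cst// integral_mkcond [RHS]integral_mkcond.
rewrite -[RHS](@integral_shift _ _ (- z)); first exact: eq_integral.
by apply/(measurable_restrictT _ mA).
Qed.

(** The threshold bounds [f] below and the ball keeps the measure finite; if all these sets were
    null, [f] would vanish almost everywhere. *)
Lemma exists_positive_level (f : euclid R d -> R) :
  measurable_fun setT f -> (forall x, 0 <= f x) ->
  (0 < \int[leb]_x (f x)%:E)%E ->
  exists k : nat,
    (0 < leb ([set x | (k.+1%:R^-1 < f x)%R] `&` (ball (0 : 'rV[R]_d) k.+1%:R)%R))%E.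
Proof.
move=> mf f0; apply: contraPP => /forallNP H; apply/negP; rewrite -leNgt.
pose E k : set (euclid R d) := [set x | k.+1%:R^-1 < f x] `&` ball (0 : 'rV[R]_d) k.+1%:R.
have mE k : measurable (E k).
  apply: measurableI; last exact: measurable_rV_ball.
  by rewrite -preimage_itvoy -[X in measurable X]setTI; exact: mf.
have E0 k : leb (E k) = 0%E.
  apply/eqP; rewrite eq_le measure_ge0 andbT leNgt; exact/negP/H.
have nE : leb (\bigcup_k E k) = 0%E.
  apply/eqP; rewrite -measure_le0.
  apply: (le_trans (measure_sigma_subadditive leb mE (bigcupT_measurable _ mE) (fun _ => id))).
  by rewrite eseries0// => i _ _; exact: E0.
rewrite (@ge0_negligible_integral _ _ _ leb setT (\bigcup_k E k))//; last 3 first.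
- exact: bigcupT_measurable.
- exact/measurable_EFinP.
- by move=> x _; rewrite lee_fin.
rewrite integral0_eq// => x [_ nEx]; congr EFin; apply/eqP; rewrite eq_le f0 andbT leNgt.
apply/negP => fx0; apply: nEx.
have [N _ HN] := near_infty_natSinv_lt (PosNum fx0).
pose k := maxn N (Num.truncn `|x : 'rV[R]_d|).
exists k => //; split; first exact: (HN k (leq_maxl _ _)).
rewrite -ball_normE/= sub0r normrN (lt_le_trans (truncnS_gt _))// ler_nat ltnS.
exact: leq_maxr.
Qed.

(** A lower-bound form of the continuity of translations in L^1. A closed set [F] of positive
    measure on which [f] exceeds a level is moved by a small [z] into a thickening of [F] whose
    excess is less than half the measure of [F]. So [F] and its translate share at least half of
    that measure, and there both terms of the minimum exceed the level. *)
Lemma translate_overlap (f : euclid R d -> R) :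
  measurable_fun setT f -> (forall x, 0 <= f x) ->
  (0 < \int[leb]_x (f x)%:E)%E ->
  exists a c : R, [/\ 0 < a, 0 < c & forall z : 'rV[R]_d, `|z| < a ->
    (c%:E <= \int[leb]_x (Num.min (f x) (f ((x : 'rV[R]_d) - z)))%:E)%E].
Proof.
move=> mf f0 /(exists_positive_level mf f0)[k].
set E := _ `&` _ => E_gt0.
have mE : measurable E.
  apply: measurableI; last exact: measurable_rV_ball.
  by rewrite -preimage_itvoy -[X in measurable X]setTI; exact: mf.
(* Regularity was shown for finite measures, hence the restriction to a ball. Its radius leaves room
   to translate [E] by vectors of norm less than 1, which is why [a] is capped by 1 below. *)
pose B2 : set (euclid R d) := ball (0 : 'rV[R]_d) k.+2%:R.
have mB2 : measurable B2 by exact: measurable_rV_ball.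
pose m : {measure set (euclid R d) -> \bar R} := mrestr leb mB2.
have mfin : (m setT < +oo)%E by rewrite /m/= /mrestr setTI; exact: lebd_ball_fin.
have EB2 : E `<=` B2.
  by move=> x [_]; apply: le_ball; rewrite ler_nat.
have mEe : m E = leb E by rewrite /m/= /mrestr setIidl.
have Efin : leb E \is a fin_num.
  rewrite ge0_fin_numE// -mEe; apply: le_lt_trans mfin; apply: le_measure; rewrite ?inE//.
have fE0 : 0 < fine (leb E) by rewrite fine_gt0// E_gt0 ltey_eq Efin.
(* An error below the measure of [E] forces [F] to have positive measure. *)
have [F [ O [cF oO FE EO mOF]]] := closed_open_regularity mfin mE fE0.
have mF : measurable (F : set (euclid R d)) by exact: closed_emeasurable.
have mFe : m F = leb F by rewrite /m/= /mrestr setIidl//; exact: subset_trans EB2.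
have F_gt0 : (0 < leb F)%E.
  rewrite lt0e measure_ge0 andbT; apply/eqP => F0.
  move: mOF; rewrite fineK// ltNge => /negP; apply.
  rewrite -mEe (measureDI m mE mF) -[X in (_ <= X)%E]adde0; apply: leeD.
    apply: le_measure; rewrite ?inE.
    - exact: measurableD.
    - by apply: measurableD => //; exact: open_emeasurable.
    - exact: setSD.
  rewrite -F0 -mFe; exact: measureIr.
have Ffin : leb F \is a fin_num.
  rewrite ge0_fin_numE// -mFe; apply: le_lt_trans mfin; apply: le_measure; rewrite ?inE//.
have fF0 : 0 < fine (leb F) by rewrite fine_gt0// F_gt0 ltey_eq Ffin.
have [a a0 ma] := thickening_small mfin cF (divr_gt0 fF0 (ltr0Sn R 1)).
exists (Num.min a 1), (k.+1%:R^-1 * (fine (leb F) / 2)); split.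
- by rewrite lt_min a0 ltr01.
- by rewrite mulr_gt0 ?invr_gt0// divr_gt0.
move=> z; rewrite lt_min => /andP[za z1].
pose G := (F : set (euclid R d)) `&` shift_set z F.
have mzF := measurable_shift_set z mF.
have mG : measurable G by exact: measurableI.
have hG : ((fine (leb F) / 2)%:E <= leb G)%E.
  have eF : (leb F = leb (shift_set z F `\` F) + leb G)%E.
    by rewrite -(lebd_shift z mF) (measureDI leb mzF mF) [_ `&` F]setIC.
  have : (leb (shift_set z F `\` F) < (fine (leb F) / 2)%:E)%E.
    apply: le_lt_trans ma; rewrite /m/= /mrestr.
    apply: le_measure; rewrite ?inE.
    - exact: measurableD.
    - apply: measurableI => //; apply: measurableD => //.
      by apply: open_emeasurable; exact: open_thickening.
    - move=> x [Fxz nFx]; split; first split => //.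
        exists ((x : 'rV[R]_d) - z) => //.
        by rewrite -ball_normE/= addrAC subrr sub0r normrN.
      have [_] := FE _ Fxz; rewrite /B2 -!ball_normE/= !sub0r !normrN => xz.
      rewrite -[X in `|X|](subrK z) (le_lt_trans (ler_normD _ _))//.
      by rewrite (lt_le_trans (ltrD xz z1))// natr1.
  have Gfin : leb G \is a fin_num.
    rewrite ge0_fin_numE//; apply: (le_lt_trans (measureIl leb mF mzF)).
    by rewrite ltey_eq Ffin.
  move: eF; rewrite -(fineK Ffin) -(fineK Gfin).
  case: (leb (shift_set z F `\` F)) => [r| |]//= [->]; rewrite lte_fin lee_fin; lra.
rewrite EFinM; apply: (@le_trans _ _ (k.+1%:R^-1%:E * leb G)%E).
  by apply: lee_pmul => //; rewrite lee_fin ?invr_ge0// divr_ge0// ltW.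
rewrite -integral_cst// integral_mkcond; apply: ge0_le_integral => //.
- by move=> x _; rewrite patchE; case: ifP => // _; rewrite lee_fin invr_ge0.
- by apply/(measurable_restrictT _ mG).
- apply/measurable_EFinP; apply: measurable_minr => //.
  exact: (measurableT_comp mf (measurable_shift_fun z)).
move=> x _; rewrite patchE; case: ifPn => [/set_mem[Fx Fxz]|_].
  by rewrite lee_fin le_min; have [/ltW -> _] := FE _ Fx; have [/ltW -> _] := FE _ Fxz.
by rewrite lee_fin le_min !f0.
Qed.

End overlap.

(** * Survival of a lazy random walk *)

Section survival.
Context {R : realType}.
Variable p : R.
Hypotheses (p_gt0 : 0 < p) (p_le1 : p <= 1).

(* Probability that a lazy simple random walk on nat started from [j], which
   moves with probability [p], has not hit 0 by time [k]. *)
Fixpoint survival (k j : nat) : R :=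
  match k, j with
  | 0, _ => (0 < j)%:R
  | _.+1, 0 => 0
  | k'.+1, j'.+1 =>
      (1 - p) * survival k' j'.+1 + p / 2 * (survival k' j' + survival k' j'.+2)
  end.

Let q_ge0 : 0 <= 1 - p. Proof. by rewrite subr_ge0. Qed.
Let p2_ge0 : 0 <= p / 2. Proof. by rewrite divr_ge0// ltW. Qed.

Lemma survival0 k : survival k 0 = 0.
Proof. by case: k. Qed.

Lemma survival_le k j : survival k.+1 j <= survival k j.
Proof.
elim: k j => [|k IH] [|j]//.
  rewrite /=; case: j => [|j] /=; rewrite ?mulr0n ?mulr1n mulr1 ?add0r ?mulr1; have := p_gt0; lra.
have := (IH j, IH j.+1, IH j.+2) => -[[h0 h1] h2].
rewrite [leRHS]/= [leLHS]/= -/(survival k.+1 j.+1) -/(survival k.+1 j.+2).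
by apply: lerD; apply: ler_wpM2l => //; exact: lerD.
Qed.

Lemma survival_nonincreasing k l j : (k <= l)%N -> survival l j <= survival k j.
Proof.
elim: l => [|l IH]; first by rewrite leqn0 => /eqP ->.
rewrite leq_eqVlt => /predU1P[->//|]; rewrite ltnS => /IH.
exact/le_trans/survival_le.
Qed.

Lemma survival_le1 k j : survival k j <= 1.
Proof.
apply: (le_trans (@survival_nonincreasing 0 k j _)) => //=.
by case: (0 < j)%N => //=; exact: ler01.
Qed.

(* [j (L - j) / p] is the expected exit time from the interval [0, L] and
   [j / L] the probability to exit at [L]. *)
Lemma sum_survival_le (L K j : nat) : (0 < L)%N -> (j <= L)%N ->
  \sum_(k < K) survival k j <=
    K%:R * (j%:R / L%:R) + j%:R * (L%:R - j%:R) / p.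
Proof.
move=> L0; elim: K j => [|K IH] j jL.
  rewrite big_ord0 mul0r add0r divr_ge0 ?(ltW p_gt0)// mulr_ge0//.
  by rewrite subr_ge0 ler_nat.
case: j jL => [|j] jL.
  rewrite big1; first by rewrite !mul0r mulr0 add0r.
  by move=> k _; rewrite survival0.
have L0R : (0 : R) < L%:R by rewrite ltr0n.
(* At the barrier [L] every later time is counted as survived, which is the source of the factor
   [K%:R]. *)
move: jL; rewrite leq_eqVlt => /predU1P[->|jL].
  rewrite subrr mulr0 mul0r addr0 divff ?gt_eqF// mulr1.
  rewrite -[leRHS]mulr_natr mul1r -[K.+1 in leRHS]card_ord -sum1_card natr_sum.
  by apply: ler_sum => k _; exact: survival_le1.
rewrite big_ord_recl /= big_split/= -2!mulr_sumr big_split/=.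
have := (IH j (ltnW (ltnW jL)), IH j.+1 (ltnW jL), IH j.+2 jL) => -[[h0 h1] h2].
set s0 := \sum_(i < K) survival i j in h0 *.
set s1 := \sum_(i < K) survival i j.+1 in h1 *.
set s2 := \sum_(i < K) survival i j.+2 in h2 *.
apply: (@le_trans _ _ (1 + ((1 - p) * (K%:R * (j.+1%:R / L%:R) + j.+1%:R * (L%:R - j.+1%:R) / p) +
  p / 2 * ((K%:R * (j%:R / L%:R) + j%:R * (L%:R - j%:R) / p)
     + (K%:R * (j.+2%:R / L%:R) + j.+2%:R * (L%:R - j.+2%:R) / p))))).
  apply: lerD => //; apply: lerD; apply: ler_wpM2l => //.
  exact: lerD.
(* The linear term is invariant under one step of the walk and the quadratic one drops by exactly 1,
   which pays for the summand at time 0; a spare [j.+1%:R / L%:R] remains. *)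
have E : K.+1%:R * (j.+1%:R / L%:R) + j.+1%:R * (L%:R - j.+1%:R) / p -
  (1 + ((1 - p) * (K%:R * (j.+1%:R / L%:R) + j.+1%:R * (L%:R - j.+1%:R) / p) +
  p / 2 * ((K%:R * (j%:R / L%:R) + j%:R * (L%:R - j%:R) / p)
     + (K%:R * (j.+2%:R / L%:R) + j.+2%:R * (L%:R - j.+2%:R) / p)))) = j.+1%:R / L%:R :> R.
  rewrite -!natr1; field.
  by rewrite !gt_eqF.
by rewrite -subr_ge0 E divr_ge0.
Qed.

(** [survival] is nonincreasing in time, so [K] times its value at time [K] is at most the sum over
    [k < K]. The barrier [L] stays free, to be taken as the square root of [K]. *)
Lemma survival_bound (L K j : nat) : (0 < L)%N -> (0 < K)%N ->
  survival K j <= j%:R / L%:R + j%:R * L%:R / (p * K%:R).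
Proof.
move=> L0 K0; have L0R : (0 : R) < L%:R by rewrite ltr0n.
have K0R : (0 : R) < K%:R by rewrite ltr0n.
have [jL|Lj] := leqP j L; last first.
  apply: (le_trans (survival_le1 _ _)).
  apply: (@le_trans _ _ (j%:R / L%:R)); first by rewrite ler_pdivlMr// mul1r ler_nat ltnW.
  by rewrite lerDl divr_ge0 ?mulr_ge0// ltW.
have : K%:R * survival K j <= K%:R * (j%:R / L%:R) + j%:R * (L%:R - j%:R) / p.
  apply: le_trans (sum_survival_le K L0 jL).
  rewrite mulr_natl -[K in _ *+ K]card_ord -sumr_const.
  by apply: ler_sum => k _; apply: survival_nonincreasing; exact: ltnW.
rewrite -ler_pdivlMl// => /le_trans; apply.
rewrite mulrDr mulKf ?gt_eqF// lerD2l.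
rewrite [leRHS](_ : _ = K%:R^-1 * (j%:R * L%:R / p)); last by field; rewrite !gt_eqF.
rewrite ler_wpM2l ?invr_ge0 ?ler0n// ler_wpM2r ?invr_ge0 ?(ltW p_gt0)//.
by rewrite ler_wpM2l// lerBlDr lerDl.
Qed.

End survival.

(** * Averages and coupling *)

Section weighted_integral.
Context d (T : measurableType d) (R : realType) (m : {measure set T -> \bar R}).
Implicit Types (w g : T -> R).

Lemma integrable_mul_bounded w g (B : R) :
  m.-integrable setT (EFin \o w) -> measurable_fun setT g ->
  (forall u, `|g u| <= B) -> m.-integrable setT (EFin \o (fun u => w u * g u)).
Proof.
move=> iw mg gB.
have mw : measurable_fun setT w by apply/measurable_EFinP; exact: measurable_int iw.
apply: (@le_integrable _ _ _ _ _ _ _ (fun u => B%:E * (EFin \o w) u)%E) => //.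
- by apply/measurable_EFinP; exact: measurable_funM.
- move=> u _ /=; rewrite lee_fin !normrM mulrC ler_wpM2r//.
  exact: le_trans (gB u) (ler_norm _).
- exact: integrableZl.
Qed.

Lemma norm_Rintegral_mul_le w g (B : R) :
  (forall u, 0 <= w u) -> m.-integrable setT (EFin \o w) ->
  measurable_fun setT g -> (forall u, `|g u| <= B) ->
  `|\int[m]_u (w u * g u)| <= B * \int[m]_u w u.
Proof.
move=> w0 iw mg gB.
have iwg := integrable_mul_bounded iw mg gB.
apply: (le_trans (le_normr_Rintegral measurableT iwg)).
rewrite -RintegralZl//; apply: le_Rintegral => //.
- exact: integrable_norm.
- exact: (integrableZl measurableT B iw).
- by move=> u _; rewrite normrM ger0_norm// mulrC ler_wpM2r.
Qed.

End weighted_integral.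

Section convolution.
Context {R : realType} {d : nat}.
Local Notation leb := (lebd R d).
Implicit Types (w g h : euclid R d -> R) (x y z : euclid R d).

(** For a density [w], the transition operator of the random walk with step density [w]. General
    weights are allowed because the coupling splits the density into pieces. *)
Definition average w g x : R := \int[leb]_u (w u * g ((x : 'rV[R]_d) + u)).

Lemma measurable_translate x : measurable_fun setT
  (fun u : euclid R d => (x : 'rV[R]_d) + u : euclid R d).
Proof.
rewrite (_ : (fun u => _) = (fun u : euclid R d => 1 *: (u : 'rV[R]_d) + x : euclid R d)).
  exact: measurable_affine.
by apply/funext => u; rewrite scale1r addrC.
Qed.

Lemma measurable_comp_translate g x : measurable_fun setT g ->
  measurable_fun setT (fun u : euclid R d => g ((x : 'rV[R]_d) + u)).
Proof. by move=> mg; exact: (measurableT_comp mg (measurable_translate x)). Qed.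

Lemma average_shift w g x z : measurable_fun setT w -> measurable_fun setT g ->
  average (fun u => w ((u : 'rV[R]_d) + z)) g x = average w g ((x : 'rV[R]_d) - z).
Proof.
move=> mw mg; congr fine.
rewrite -[RHS](@integral_shift _ _ z).
  by apply: eq_integral => u _; rewrite -addrA [- _ + (_ + _)]addrC addrK.
apply/measurable_EFinP; apply: measurable_funM => //.
exact: measurable_comp_translate.
Qed.

(** Adding [B] to [g] makes the integrand nonnegative, so that the measurability part of Tonelli
    applies; the price is a constant. *)
Lemma measurable_average w g (B : R) :
  leb.-integrable setT (EFin \o w) -> measurable_fun setT g ->
  (forall u, 0 <= w u) -> (forall u, `|g u| <= B) ->
  measurable_fun setT (average w g).
Proof.
move=> iw mg w0 gB.
have mw : measurable_fun setT w by apply/measurable_EFinP; exact: measurable_int iw.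
have gB0 u : 0 <= g u + B by have := gB u; rewrite ler_norml => /andP[? _]; lra.
have mgB : measurable_fun setT (fun u => g u + B) by exact: measurable_funD.
have gBb u : `|g u + B| <= B + B.
  by rewrite ger0_norm// lerD2r; exact: le_trans (ler_norm _) (gB u).
have -> : average w g = fun x => average w (fun u => g u + B) x - \int[leb]_u (w u * B).
  apply/funext => x; rewrite /average -RintegralB//.
  - by apply: eq_Rintegral => u _; ring.
  - apply: integrable_mul_bounded iw _ _; first exact: measurable_comp_translate mgB.
    by move=> u; exact: gBb.
  - by apply: (integrable_mul_bounded (B := `|B|)) iw _ _.
apply: measurable_funB => //.
pose f := fun p : euclid R d * euclid R d => (w p.2 * (g ((p.1 : 'rV[R]_d) + p.2) + B))%:E.
apply: (@measurableT_comp _ _ _ _ _ _ fine _ (fubini_F leb f)) => //.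
apply: measurable_fun_fubini_tonelli_F => //; last first.
  by move=> p; rewrite lee_fin mulr_ge0.
apply/measurable_EFinP; apply: measurable_funM; first exact: measurableT_comp.
exact: (measurableT_comp mgB (@measurable_eadd R d)).
Qed.

(** Synchronous coupling: both walks take the same increment [u]. *)
Lemma average_dist w g (B : R) (b : R) x y :
  leb.-integrable setT (EFin \o w) -> measurable_fun setT g ->
  (forall u, 0 <= w u) -> (forall u, `|g u| <= B) ->
  (forall u : euclid R d, `|g ((x : 'rV[R]_d) + u) - g ((y : 'rV[R]_d) + u)| <= b) ->
  `|average w g x - average w g y| <= b * \int[leb]_u w u.
Proof.
move=> iw mg w0 gB gb.
have mx := measurable_comp_translate x mg; have my := measurable_comp_translate y mg.
rewrite /average -RintegralB//; last 2 first.
- exact: integrable_mul_bounded iw mx (fun u => gB _).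
- exact: integrable_mul_bounded iw my (fun u => gB _).
under eq_Rintegral do rewrite -mulrBr.
by apply: norm_Rintegral_mul_le => //; exact: measurable_funB.
Qed.

End convolution.

(** * Coupling of two walks with a common step density *)

Section density.
Context {R : realType} {d : nat}.
Local Notation leb := (lebd R d).
Implicit Types (g h : euclid R d -> R) (x y z : euclid R d).

Variable f : euclid R d -> R.
Hypothesis f_density : is_density f.

Let mf : measurable_fun setT f. Proof. by case: f_density. Qed.
Let f0 u : 0 <= f u. Proof. by case: f_density. Qed.
Let intf : (\int[leb]_u (f u)%:E = 1)%E. Proof. by case: f_density. Qed.
Let Rintf : \int[leb]_u f u = 1. Proof. by rewrite /Rintegral intf. Qed.

Lemma density_integrable : leb.-integrable setT (EFin \o f).
Proof.
apply/integrableP; split; first exact/measurable_EFinP.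
under eq_integral do rewrite /= ger0_norm//.
by rewrite intf ltry.
Qed.
Let intgf := density_integrable.

Lemma norm_average_le g (B : R) x :
  measurable_fun setT g -> (forall u, `|g u| <= B) -> `|average f g x| <= B.
Proof.
move=> mg gB; rewrite -[leRHS]mulr1 -Rintf.
by apply: norm_Rintegral_mul_le => //; exact: measurable_comp_translate.
Qed.

Lemma iter_average_bounded g (B : R) k :
  measurable_fun setT g -> (forall u, `|g u| <= B) ->
  measurable_fun setT (iter k (average f) g) /\
  forall u, `|iter k (average f) g u| <= B.
Proof.
move=> mg gB; elim: k => [//|k [mk kB]]; split=> [|u] /=.
  exact: measurable_average intgf mk f0 kB.
exact: norm_average_le.
Qed.

(** One minus the total variation distance between [f] and its translate by [z]; it becomes the
    moving probability of the lazy walk. *)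
Definition overlap z : R := \int[leb]_u Num.min (f u) (f ((u : 'rV[R]_d) - z)).

Let min_f z u := Num.min (f u) (f ((u : 'rV[R]_d) - z)).

Let measurable_min_f z : measurable_fun setT (min_f z).
Proof. by apply: measurable_minr => //; exact: (measurableT_comp mf (measurable_shift_fun z)). Qed.

Let min_f_ge0 z u : 0 <= min_f z u.
Proof. by rewrite le_min !f0. Qed.

Let intg_min_f z : leb.-integrable setT (EFin \o min_f z).
Proof.
apply: (le_integrable _ _ _ intgf) => //; first exact/measurable_EFinP.
by move=> u _ /=; rewrite lee_fin !ger0_norm// ge_min lexx.
Qed.

Lemma overlap_le1 z : overlap z <= 1.
Proof.
rewrite -Rintf; apply: le_Rintegral => //; first exact: intg_min_f.
by move=> u _; rewrite ge_min lexx.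
Qed.

(* With [m = min (f, f (. - z))], [f] dominates the average of [m] and
   [m (. + z)]; the walks started at [x] and [x + j z] are coupled by making one
   of them follow the first half when the other one follows the second. *)
Lemma coupling_step g (B : R) (b : nat -> R) z :
  measurable_fun setT g -> (forall u, `|g u| <= B) ->
  (forall j x, `|g x - g ((x : 'rV[R]_d) + (z : 'rV[R]_d) *+ j)| <= b j) ->
  forall j x, `|average f g x - average f g ((x : 'rV[R]_d) + (z : 'rV[R]_d) *+ j.+1)| <=
    (1 - overlap z) * b j.+1 + overlap z / 2 * (b j + b j.+2).
Proof.
move=> mg gB gb j x.
pose m1 : euclid R d -> R := min_f z.
pose m2 (u : euclid R d) : R := m1 ((u : 'rV[R]_d) + z).
pose nu (u : euclid R d) : R := f u - 2^-1 * m1 u - 2^-1 * m2 u.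
have Em2 u : m2 u = Num.min (f ((u : 'rV[R]_d) + z)) (f u).
  by rewrite /m2 /m1 /min_f addrK.
have mm2 : measurable_fun setT m2.
  apply: (measurableT_comp (measurable_min_f z)).
  have := @measurable_shift_fun R d (- (z : 'rV[R]_d)).
  by rewrite opprK.
have m1_ge0 u : 0 <= m1 u by exact: min_f_ge0.
have m2_ge0 u : 0 <= m2 u by exact: min_f_ge0.
have nu_ge0 u : 0 <= nu u.
  have h1 : m1 u <= f u by rewrite ge_min lexx.
  have h2 : m2 u <= f u by rewrite Em2 ge_min lexx orbT.
  by rewrite /nu; lra.
have im1 : leb.-integrable setT (EFin \o m1) by exact: intg_min_f.
have im2 : leb.-integrable setT (EFin \o m2).
  apply: (le_integrable _ _ _ intgf) => //; first exact/measurable_EFinP.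
  by move=> u _ /=; rewrite lee_fin !ger0_norm// Em2 ge_min lexx orbT.
have ihm1 : leb.-integrable setT (EFin \o (fun u => 2^-1 * m1 u)).
  exact: (integrableZl measurableT 2^-1 im1).
have ihm2 : leb.-integrable setT (EFin \o (fun u => 2^-1 * m2 u)).
  exact: (integrableZl measurableT 2^-1 im2).
have ifm1 : leb.-integrable setT (EFin \o (fun u => f u - 2^-1 * m1 u)).
  exact: (integrableB measurableT intgf ihm1).
have inu : leb.-integrable setT (EFin \o nu).
  exact: (integrableB measurableT ifm1 ihm2).
have Im2 : \int[leb]_u m2 u = overlap z.
  congr fine; rewrite -[RHS](@integral_shift _ _ z); first by [].
  by apply/measurable_EFinP; exact: measurable_min_f.
have Inu : \int[leb]_u nu u = 1 - overlap z.
  rewrite /nu RintegralB// RintegralB// !RintegralZl// Im2 Rintf /overlap -/m1.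
  rewrite -[\int[leb]_u m1 u]/(overlap z); lra.
(* Carrying [m2] back by [z] moves the base point instead of the weight. Pairing the halves
   crosswise then turns a distance of [j.+1] steps into [j] or [j.+2]. *)
have dec y : average f g y = average nu g y +
    (2^-1 * average m1 g y + 2^-1 * average m1 g ((y : 'rV[R]_d) - z)).
  have my := measurable_comp_translate y mg.
  have J w : leb.-integrable setT (EFin \o w) ->
     leb.-integrable setT (EFin \o (fun u => w u * g ((y : 'rV[R]_d) + u))).
    by move=> iw; exact: (integrable_mul_bounded iw my (fun u => gB _)).
  rewrite -(average_shift _ _ (measurable_min_f z) mg) -/m2 /average.
  rewrite -!RintegralZl//; try exact: J.
  have J1 := J _ im1; have J2 := J _ im2; have Jnu := J _ inu.
  have K1 := integrableZl measurableT 2^-1 J1.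
  have K2 := integrableZl measurableT 2^-1 J2.
  rewrite -RintegralD//; rewrite -RintegralD//; last exact: (integrableD measurableT K1 K2).
  by apply: eq_Rintegral => u _; rewrite /nu /m2; lra.
set y : euclid R d := (x : 'rV[R]_d) + (z : 'rV[R]_d) *+ j.+1.
have d1 : `|average nu g x - average nu g y| <= b j.+1 * (1 - overlap z).
  rewrite -Inu; apply: (average_dist inu mg nu_ge0 gB) => u.
  by rewrite /y addrAC; exact: gb.
have d2 : `|average m1 g x - average m1 g ((y : 'rV[R]_d) - z)| <= b j * overlap z.
  apply: (average_dist im1 mg m1_ge0 gB) => u.
  have -> : (y : 'rV[R]_d) - z + u = x + u + (z : 'rV[R]_d) *+ j.
    by rewrite /y mulrSr addrA addrK addrAC.
  exact: gb.
have d3 : `|average m1 g ((x : 'rV[R]_d) - z) - average m1 g y| <= b j.+2 * overlap z.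
  apply: (average_dist im1 mg m1_ge0 gB) => u.
  have -> : (y : 'rV[R]_d) + u = x - z + u + (z : 'rV[R]_d) *+ j.+2.
    by rewrite /y (mulrS _ j.+1) addrA [_ + u + z]addrAC subrK addrAC.
  exact: gb.
rewrite (dec x) (dec y); move: d1 d2 d3; rewrite !ler_norml.
move=> /andP[? ?] /andP[? ?] /andP[? ?]; apply/andP; split; lra.
Qed.

(** The bounds of [coupling_step] obey the recursion defining [survival]. Index 0 is absorbing
    because the two base points then coincide, and [2 * B] bounds any difference at time 0. *)
Lemma coupling_iter g (B : R) z :
  measurable_fun setT g -> (forall u, `|g u| <= B) -> 0 < overlap z ->
  forall k j x, `|iter k (average f) g x -
      iter k (average f) g ((x : 'rV[R]_d) + (z : 'rV[R]_d) *+ j)| <=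
    2 * B * survival (overlap z) k j.
Proof.
move=> mg gB z0; elim=> [|k IH] j x.
  case: j => [|j]; first by rewrite mulr0n addr0 subrr normr0 mulr0.
  rewrite /= mulr1 (le_trans (ler_normB _ _))// mulr_natl mulr2n.
  by rewrite lerD.
case: j => [|j]; first by rewrite mulr0n addr0 subrr normr0 survival0 mulr0.
have [mk kB] := iter_average_bounded k mg gB.
apply: (le_trans (coupling_step mk kB (IH : forall j x, _ <= (fun j => _ * survival _ k j) j) j x)).
rewrite /= le_eqVlt; apply/orP; left; apply/eqP; ring.
Qed.

End density.

Section enorm.
Context {R : realType} {d : nat}.
Implicit Types x y : 'rV[R]_d.

Lemma enorm2E x : enorm (x : euclid R d) ^+ 2 = \sum_i x 0 i ^+ 2.
Proof. by rewrite sqr_sqrtr// sumr_ge0// => i _; rewrite sqr_ge0. Qed.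

Lemma enorm_ge0 x : 0 <= enorm (x : euclid R d).
Proof. exact: sqrtr_ge0. Qed.

Lemma enormZ (a : R) x : enorm (a *: x : euclid R d) = `|a| * enorm (x : euclid R d).
Proof.
rewrite /enorm -sqrtr_sqr -sqrtrM ?sqr_ge0// mulr_sumr.
by congr Num.sqrt; apply: eq_bigr => i _; rewrite /ecoord mxE exprMn.
Qed.

Lemma enorm_parallelogram x y :
  enorm (x + y : euclid R d) ^+ 2 + enorm (x - y : euclid R d) ^+ 2 =
  2 * enorm (x : euclid R d) ^+ 2 + 2 * enorm (y : euclid R d) ^+ 2.
Proof.
rewrite !enorm2E !mulr_sumr -!big_split/=.
by apply: eq_bigr => i _; rewrite !mxE; ring.
Qed.

Lemma norm_le_enorm x : `|x| <= enorm (x : euclid R d).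
Proof.
rewrite [leLHS]/Num.norm /= mx_normrE; apply/bigmax_leP; split=> [|[i j] _]; first exact: enorm_ge0.
rewrite /= (ord1 i) -sqrtr_sqr ler_wsqrtr// (bigD1 j)//= lerDl.
by apply: sumr_ge0 => k _; exact: sqr_ge0.
Qed.

End enorm.

(** * Second moments and comparison of [h] with its iterated averages *)

Section symmetric_density.
Context {R : realType} {d : nat}.
Local Notation leb := (lebd R d).
Implicit Types (g h : euclid R d -> R) (x y z : euclid R d).

Variables (f : euclid R d -> R) (s : R).
Hypothesis f_density : is_density f.
Hypothesis f_sym : forall x, f x = f (- (x : 'rV[R]_d)).
Hypothesis f_moment : (\int[leb]_u (enorm u ^+ 2 * f u)%:E = s%:E)%E.

Let mf : measurable_fun setT f. Proof. by case: f_density. Qed.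
Let f0 u : 0 <= f u. Proof. by case: f_density. Qed.
Let intf : (\int[leb]_u (f u)%:E = 1)%E. Proof. by case: f_density. Qed.
Let intgf := density_integrable f_density.

Let measurable_enorm2_translate x : measurable_fun setT
  (fun u : euclid R d => enorm ((x : 'rV[R]_d) + u : euclid R d) ^+ 2).
Proof. exact: (measurableT_comp (@measurable_enorm2 R d) (measurable_translate x)). Qed.

(* By symmetry of [f], averaging the parallelogram identity removes the cross term. *)
Lemma second_moment_translate x :
  (\int[leb]_u (f u * enorm ((x : 'rV[R]_d) + u : euclid R d) ^+ 2)%:E =
   (enorm x ^+ 2 + s)%:E)%E.
Proof.
have mI (y : euclid R d) : measurable_fun setT
    (fun u : euclid R d => (f u * enorm ((y : 'rV[R]_d) + u : euclid R d) ^+ 2)%:E).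
  by apply/measurable_EFinP; exact: measurable_funM.
have I0 (y u : euclid R d) : (0 <= (f u * enorm ((y : 'rV[R]_d) + u : euclid R d) ^+ 2)%:E)%E.
  by rewrite lee_fin mulr_ge0// sqr_ge0.
set I := (\int[leb]_u _)%E.
have I' : I = (\int[leb]_u (f u * enorm ((x : 'rV[R]_d) - u : euclid R d) ^+ 2)%:E)%E.
  rewrite /I -(ge0_integral_reflect (mI x) (I0 x)).
  by apply: eq_integral => u _; rewrite -f_sym.
have mI' : measurable_fun setT
    (fun u : euclid R d => (f u * enorm ((x : 'rV[R]_d) - u : euclid R d) ^+ 2)%:E).
  have := @measurable_affine R d (-1) 0.
  move=> /(measurableT_comp (mI x)); apply: eq_measurable_fun => u _ /=.
  by rewrite addr0 scaleN1r -f_sym.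
have II : (I + I = (2 * (enorm x ^+ 2 + s))%:E)%E.
  rewrite {2}I' -ge0_integralD//; last first.
    by move=> u _; rewrite lee_fin mulr_ge0// sqr_ge0.
  transitivity (\int[leb]_u ((2 * enorm x ^+ 2)%:E * (f u)%:E + 2%:E * (enorm u ^+ 2 * f u)%:E))%E.
    apply: eq_integral => u _; rewrite -!EFinM -!EFinD; congr EFin.
    by rewrite -mulrDr enorm_parallelogram; ring.
  have me : measurable_fun setT (fun u : euclid R d => (enorm u ^+ 2 * f u)%:E).
    by apply/measurable_EFinP; apply: measurable_funM => //; exact: measurable_enorm2.
  have e0 (u : euclid R d) : (0 <= (enorm u ^+ 2 * f u)%:E)%E.
    by rewrite lee_fin mulr_ge0// sqr_ge0.
  rewrite ge0_integralD//; last 4 first.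
  - by move=> u _; rewrite -EFinM lee_fin mulr_ge0// mulr_ge0// sqr_ge0.
  - by apply: emeasurable_funM => //; exact/measurable_EFinP.
  - by move=> u _; rewrite mule_ge0.
  - by apply: emeasurable_funM.
  rewrite ge0_integralZl//; last 3 first.
  - exact/measurable_EFinP.
  - by move=> u _; rewrite lee_fin.
  - by rewrite lee_fin mulr_ge0// sqr_ge0.
  rewrite ge0_integralZl// intf f_moment mule1 -EFinM -EFinD; congr EFin; ring.
have Ige : (0 <= I)%E by exact: integral_ge0.
by move: II Ige; clear I'; case: I => [r| |]//= [] ? _; congr EFin; lra.
Qed.

Lemma integrable_second_moment_translate x :
  leb.-integrable setT (EFin \o (fun u => f u * enorm ((x : 'rV[R]_d) + u : euclid R d) ^+ 2)).
Proof.
apply/integrableP; split; first by apply/measurable_EFinP; exact: measurable_funM.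
rewrite (eq_integral (fun u => (f u * enorm ((x : 'rV[R]_d) + u : euclid R d) ^+ 2)%:E)).
  by rewrite second_moment_translate ltry.
by move=> u _; rewrite /= ger0_norm// mulr_ge0// sqr_ge0.
Qed.

Let s_ge0 : 0 <= s.
Proof.
by rewrite -lee_fin -f_moment integral_ge0// => u _; rewrite lee_fin mulr_ge0// sqr_ge0.
Qed.

(** Applied later only at [y := x]. The induction needs every [y], since one average may reach any
    point of the space, including those where [h] fails the mean value property. *)
Lemma local_mean_value_iter h (B : R) (x : euclid R d) (r : R) : 0 < r ->
  measurable_fun setT h -> (forall u, `|h u| <= B) ->
  (forall y, enorm ((y : 'rV[R]_d) - x : euclid R d) < r -> h y = average f h y) ->
  forall k y, `|h y - iter k (average f) h y| <=
    2 * B * ((enorm ((y : 'rV[R]_d) - x : euclid R d) ^+ 2 + k%:R * s) / r ^+ 2).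
Proof.
move=> r0 mh hB hav k.
have B0 : 0 <= B by apply: le_trans (hB (0 : 'rV[R]_d)).
elim: k => [|k IH] y.
  rewrite subrr normr0; apply: mulr_ge0; first exact: mulr_ge0.
  by rewrite divr_ge0 ?sqr_ge0// mul0r addr0 sqr_ge0.
have [mk kB] := iter_average_bounded f_density k mh hB.
have [yr|ry] := ltP (enorm ((y : 'rV[R]_d) - x : euclid R d)) r; last first.
  have [_ kB1] := iter_average_bounded f_density k.+1 mh hB.
  apply: (@le_trans _ _ (2 * B)).
    by rewrite (le_trans (ler_normB _ _))// mulr_natl mulr2n lerD.
  rewrite ler_peMr ?mulr_ge0// ler_pdivlMr ?exprn_gt0// mul1r.
  rewrite -[leLHS]addr0 lerD ?mulr_ge0//.
  by rewrite ler_pXn2r// ?nnegrE ?enorm_ge0// ltW.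
rewrite hav//= /average.
have my := measurable_comp_translate y mh; have mky := measurable_comp_translate y mk.
have J1 := integrable_mul_bounded intgf my (fun u => hB _).
have J2 := integrable_mul_bounded intgf mky (fun u => kB _).
rewrite -RintegralB//.
apply: (le_trans (le_normr_Rintegral measurableT _)); first exact: (integrableB measurableT J1 J2).
have J := integrable_second_moment_translate ((y : 'rV[R]_d) - x).
pose c := 2 * B / r ^+ 2.
have K1 := integrableZl measurableT c J.
have K2 := integrableZl measurableT (c * (k%:R * s)) intgf.
apply: (@le_trans _ _ (\int[leb]_u (c * (f u * enorm ((y : 'rV[R]_d) - x + u : euclid R d) ^+ 2)
    + c * (k%:R * s) * f u))).
  apply: le_Rintegral => //.
  - exact: (integrable_norm (integrableB measurableT J1 J2)).
  - exact: (integrableD measurableT K1 K2).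
  - move=> u _; rewrite -mulrBr normrM ger0_norm//.
    apply: (le_trans (ler_wpM2l (f0 u) (IH _))).
    rewrite /c [_ + u - x]addrAC le_eqVlt; apply/orP; left; apply/eqP; field.
    by rewrite gt_eqF.
rewrite RintegralD// RintegralZl// RintegralZl//.
rewrite /Rintegral second_moment_translate intf/= mulr1 /c -natr1.
by rewrite le_eqVlt; apply/orP; left; apply/eqP; field; rewrite gt_eqF.
Qed.

End symmetric_density.

(** * One-step mean value property *)

Section integral_complements.
Context d (T : measurableType d) (R : realType).
Import HBNNSimple.

(** The hypothesis is the identity for indicators; it extends to simple functions by linearity and
    to [f] by monotone convergence. *)
Lemma ge0_integral_density (m1 m2 : {measure set T -> \bar R}) (q : T -> R)
    (f : T -> \bar R) :
  measurable_fun setT q -> (forall x, 0 <= q x) ->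
  (forall A, measurable A -> m1 A = \int[m2]_(x in A) (q x)%:E)%E ->
  measurable_fun setT f -> (forall x, 0 <= f x)%E ->
  (\int[m1]_x f x = \int[m2]_x (f x * (q x)%:E))%E.
Proof.
move=> mq q0 m1E mf f0; pose h := nnsfun_approx measurableT mf.
have mEq : measurable_fun setT (fun x => (q x)%:E) by exact/measurable_EFinP.
have -> : (\int[m1]_x f x = lim (\int[m1]_x (EFin \o h n) x @[n --> \oo]))%E.
  have fE x : f x = lim ((EFin \o h n) x @[n --> \oo]).
    by apply/esym/cvg_lim => //; exact: cvg_nnsfun_approx.
  under eq_integral => x _ do rewrite fE.
  apply: monotone_convergence => //.
  - by move=> n; apply/measurable_EFinP; exact/measurable_funP.
  - by move=> n x _ //=; rewrite lee_fin.
  - by move=> x _ a b ab; rewrite lee_fin; exact/lefP/nd_nnsfun_approx.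
have -> : (\int[m2]_x (f x * (q x)%:E) =
    lim (\int[m2]_x ((EFin \o h n) x * (q x)%:E) @[n --> \oo]))%E.
  have fq x : (f x * (q x)%:E = lim (((EFin \o h n) x * (q x)%:E)%E @[n --> \oo]))%E.
    by apply/esym/cvg_lim => //; apply: cvgeZr => //; exact: cvg_nnsfun_approx.
  under eq_integral => x _ do rewrite fq.
  apply: monotone_convergence => //.
  - by move=> n; apply: emeasurable_funM => //; apply/measurable_EFinP.
  - by move=> n x _ /=; rewrite mule_ge0 ?lee_fin.
  - by move=> x _ a b ab/=; rewrite lee_wpmul2r ?lee_fin//; exact/lefP/nd_nnsfun_approx.
suff suf n : (\int[m2]_x ((EFin \o h n) x * (q x)%:E) = \int[m1]_x (EFin \o h n) x)%E.
  by under [in RHS]eq_fun do rewrite suf.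
transitivity (\int[m1]_x
    (\sum_(y \in range (h n)) (y * \1_(h n @^-1` [set y]) x)%:E))%E; last first.
  by apply: eq_integral => t _; rewrite /= fimfunE -fsumEFin.
have indich r : measurable_fun setT (fun x => (r * \1_(h n @^-1` [set r]) x)%:E).
  by apply: measurableT_comp => //; exact: measurable_funM.
rewrite ge0_integral_fsum//; last by move=> m y Ey; exact: nnfun_muleindic_ge0.
transitivity (\int[m2]_x (\sum_(y \in range (h n)) (y * \1_(h n @^-1` [set y]) x)%:E * (q x)%:E))%E.
  under [RHS]eq_integral => x _.
    rewrite -ge0_mule_fsuml => [|y]; last exact: nnfun_muleindic_ge0.
    rewrite fsumEFin // -(fimfunE _ x); over.
  by [].
rewrite ge0_integral_fsum//; last 2 first.
  - by move=> y; exact: emeasurable_funM.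
  - by move=> m y Ey; apply: mule_ge0; [exact: nnfun_muleindic_ge0|rewrite lee_fin].
apply: eq_fsbigr => r rhn.
under [RHS]eq_integral do rewrite EFinM.
rewrite integralZl_indic_nnsfun => //.
under eq_integral do rewrite EFinM -muleA.
rewrite ge0_integralZl//.
- under eq_integral do rewrite muleC.
  rewrite (eq_integral ((EFin \o q) \_ (h n @^-1` [set r]))); last first.
    by move=> x _; rewrite epatch_indic.
  by rewrite -integral_mkcond -m1E// integral_indic// setIT.
- by apply: emeasurable_funM => //; exact/measurable_EFinP.
- by move=> t _; rewrite mule_ge0 ?lee_fin.
- by move: rhn; rewrite inE => -[t _ <-]; rewrite lee_fin.
Qed.

(** The integral of a nonnegative function is a supremum over the simple functions below it, hence
    monotone. This is how exit values, whose measurability is not established, are handled. *)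
Lemma ge0_le_integral_nonmeasurable (m : {measure set T -> \bar R}) (f g : T -> \bar R) :
  (forall x, 0 <= f x)%E -> (forall x, f x <= g x)%E ->
  (\int[m]_x f x <= \int[m]_x g x)%E.
Proof.
move=> f0 fg; rewrite !ge0_integralTE//; last by move=> x; exact: le_trans (fg x).
apply: le_ereal_sup => _ [k /= kf <-]; exists k => //= x.
exact: le_trans (fg x).
Qed.

(** Additivity is applied only to [g], its restriction to [G] and the indicator of the complement of
    [G]; [f] enters through monotonicity alone. *)
Lemma ge0_integral_close (P : probability T R) (f g : T -> R) (G : set T) (M : R) :
  measurable G -> measurable_fun setT g ->
  (forall x, 0 <= f x <= M) -> (forall x, 0 <= g x <= M) ->
  (forall x, G x -> f x = g x) ->
  exists a b : R, [/\ (\int[P]_x (f x)%:E)%E = a%:E, (\int[P]_x (g x)%:E)%E = b%:E &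
    `|a - b| <= M * fine (P (~` G))].
Proof.
move=> mG mg fM gM fg.
have mGc : measurable (~` G) by exact: measurableC.
have M0 (x : T) : 0 <= M by have /andP[h1 h2] := fM x; exact: le_trans h1 h2.
have f0 x : 0 <= f x by case/andP: (fM x).
have g0 x : 0 <= g x by case/andP: (gM x).
have PGfin : P (~` G) \is a fin_num by exact: fin_num_measure.
have I1 : (\int[P]_x (M * \1_(~` G) x)%:E = (M * fine (P (~` G)))%:E)%E.
  under eq_integral do rewrite EFinM.
  rewrite integralZl//; last exact: integrable_indic.
  by rewrite integral_indic// setIT EFinM fineK.
have mind : measurable_fun setT (fun x => (M * \1_(~` G) x)%:E).
  by apply/measurable_EFinP; exact: measurable_funM.
have fb : (\int[P]_x (f x)%:E <= \int[P]_x (g x)%:E + (M * fine (P (~` G)))%:E)%E.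
  rewrite -I1 -ge0_integralD//; last 3 first.
  - by move=> x _; rewrite lee_fin.
  - exact/measurable_EFinP.
  - by move=> x _; rewrite lee_fin mulr_ge0// (M0 x).
  apply: ge0_le_integral_nonmeasurable => x; first by rewrite lee_fin.
  rewrite -EFinD lee_fin indicE; have [/set_mem nGx|nGx] := boolP (x \in ~` G).
    by rewrite mulr1 -[leLHS]add0r lerD//; case/andP: (fM x).
  rewrite mulr0 addr0 fg//; apply: contrapT => Gx; move/negP: nGx; apply.
  exact: mem_set.
have gb : (\int[P]_x (g x)%:E <= \int[P]_x (f x)%:E + (M * fine (P (~` G)))%:E)%E.
  have mgG : measurable_fun setT (fun x => (g x * \1_G x)%:E).
    by apply/measurable_EFinP; exact: measurable_funM.
  apply: (@le_trans _ _ (\int[P]_x (g x * \1_G x)%:E + (M * fine (P (~` G)))%:E)%E).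
    rewrite -I1 -ge0_integralD//; last 2 first.
    - by move=> x _; rewrite lee_fin mulr_ge0.
    - by move=> x _; rewrite lee_fin mulr_ge0// (M0 x).
    apply: ge0_le_integral_nonmeasurable => x; first by rewrite lee_fin.
    rewrite -EFinD lee_fin !indicE in_setC; case: (x \in G) => /=.
      by rewrite mulr1 mulr0 addr0.
    by rewrite mulr1 mulr0 add0r; case/andP: (gM x).
  rewrite leeD2r//; apply: ge0_le_integral_nonmeasurable => x.
    by rewrite lee_fin mulr_ge0.
  rewrite lee_fin indicE; have [/set_mem Gx|] := boolP (x \in G); last by rewrite mulr0.
  by rewrite mulr1 fg.
have gfin : (\int[P]_x (g x)%:E \is a fin_num)%E.
  rewrite ge0_fin_numE; last by apply: integral_ge0 => x _; rewrite lee_fin.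
  apply: (@le_lt_trans _ _ (\int[P]_x cst M%:E x)%E).
    apply: ge0_le_integral_nonmeasurable => x; rewrite lee_fin//.
    by case/andP: (gM x).
  by rewrite integral_cst// ltey_eq fin_numM//; exact: fin_num_measure.
have ffin : (\int[P]_x (f x)%:E \is a fin_num)%E.
  rewrite ge0_fin_numE; last by apply: integral_ge0 => x _; rewrite lee_fin.
  by apply: (le_lt_trans fb); rewrite -(fineK gfin) -EFinD ltry.
exists (fine (\int[P]_x (f x)%:E)), (fine (\int[P]_x (g x)%:E)); rewrite !fineK//; split=> //.
move: fb gb; rewrite -(fineK ffin) -(fineK gfin) -!EFinD !lee_fin/=.
by rewrite ler_norml lerNl opprB !lerBlDl => -> ->.
Qed.

(** Here [f] will be the exit value and [A] the event that the exit time is finite. The factor 2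
    comes from treating positive and negative parts separately. *)
Lemma integral_close (P : probability T R) (f g : T -> R) (A G : set T) (M a : R) :
  measurable G -> measurable_fun setT g ->
  (forall x, `|f x| <= M) -> (forall x, `|g x| <= M) ->
  G `<=` A -> (forall x, G x -> f x = g x) ->
  (\int[P]_(x in A) (f x)%:E)%E = a%:E ->
  `|a - \int[P]_x g x| <= 2 * M * fine (P (~` G)).
Proof.
move=> mG mg fM gM GA fg; rewrite integral_mkcond.
have -> : (EFin \o f) \_ A = EFin \o (f \_ A) by rewrite restrict_EFin.
pose fA := f \_ A.
have fAM x : `|fA x| <= M.
  by rewrite /fA patchE; case: ifP => // _; rewrite normr0; exact: le_trans (fM x).
have fAg x : G x -> fA x = g x.
  by move=> Gx; rewrite /fA patchE mem_set ?fg//; exact: GA.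
have posM (u : T -> R) x : `|u x| <= M -> 0 <= u^\+ x <= M.
  move=> uM; rewrite /funrpos le_max lexx orbT/= ge_max.
  by rewrite (le_trans (ler_norm _) uM) (le_trans (normr_ge0 _) uM).
have negM (u : T -> R) x : `|u x| <= M -> 0 <= u^\- x <= M.
  move=> uM; rewrite /funrneg le_max lexx orbT/= ge_max.
  by rewrite (le_trans (ler_norm _)) ?normrN// (le_trans (normr_ge0 _) uM).
have [a1 [b1 [fa1 gb1 ab1]]] := @ge0_integral_close P fA^\+ g^\+ G M mG
  (measurable_funrpos mg) (fun x => posM _ _ (fAM x)) (fun x => posM _ _ (gM x))
  (fun x Gx => congr1 (fun t => Num.max t 0) (fAg x Gx)).
have [a2 [b2 [fa2 gb2 ab2]]] := @ge0_integral_close P fA^\- g^\- G M mG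
  (measurable_funrneg mg) (fun x => negM _ _ (fAM x)) (fun x => negM _ _ (gM x))
  (fun x Gx => congr1 (fun t => Num.max (- t) 0) (fAg x Gx)).
have E (u : T -> R) : (\int[P]_x (u x)%:E = \int[P]_x (u^\+ x)%:E - \int[P]_x (u^\- x)%:E)%E.
  by rewrite integralE; congr (_ - _)%E; apply: eq_integral => x _;
    rewrite ?funeposE ?funenegE /funrpos /funrneg/= -?EFinN -EFin_max.
rewrite /Rintegral E fa1 fa2 E gb1 gb2 -!EFinB/= => -[<-].
rewrite (_ : a1 - a2 - (b1 - b2) = (a1 - b1) - (a2 - b2)); last by ring.
apply: (le_trans (ler_normB _ _)); apply: (le_trans (lerD ab1 ab2)).
by rewrite -mulrA mulr_natl mulr2n.
Qed.

End integral_complements.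

Section small_balls.
Context {R : realType} {d : nat}.
Local Notation leb := (lebd R d).

Lemma lebd_ball (x : 'rV[R]_d) (e : R) : 0 < e ->
  leb (ball x e) = ((e ^+ d)%:E * leb (ball (0 : 'rV[R]_d) 1)%R)%E.
Proof.
move=> e0.
have mB y r : measurable (ball y r : set (euclid R d)) by exact: measurable_rV_ball.
have I A : measurable A -> leb A = (\int[leb]_u (\1_A u)%:E)%E.
  by move=> mA; rewrite integral_indic// setIT.
rewrite (I _ (mB x e)) (I _ (mB (0 : 'rV[R]_d) 1)) (@ge0_integral_affine _ _ e x)//; last 2 first.
- by rewrite gt_eqF.
- exact/measurable_EFinP.
rewrite gtr0_norm//; congr *%E; apply: eq_integral => u _; rewrite !indicE; congr (_%:R)%:E.
congr nat_of_bool; apply/asboolP/asboolP; rewrite -!ball_normE/= sub0r normrN.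
  by rewrite opprD addrCA subrr addr0 normrN normrZ gtr0_norm// gtr_pMr.
by rewrite opprD addrCA subrr addr0 normrN normrZ gtr0_norm// gtr_pMr.
Qed.

Lemma closed_ball_sub_open (x : 'rV[R]_d) (U : set 'rV[R]_d) : open U -> U x ->
  exists2 e : R, 0 < e & forall r, 0 < r -> r <= e ->
    closure (ball x r) `<=` U /\ compact (closure (ball x r)).
Proof.
move=> oU Ux.
have /nbhs_ballP[e /= e0 eU] : nbhs x U by exact: open_nbhs_nbhs.
exists (e / 2); first by rewrite divr_gt0.
move=> r r0 re; rewrite -/(closed_ball x r) closed_ballE//; split.
  apply: subset_trans eU => y /=; rewrite /closed_ball_/= -ball_normE/= => /le_lt_trans; apply.
  by rewrite (le_lt_trans re)// ltr_pdivrMr// ltr_pMr// ltr1n.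
apply: bounded_closed_compact; last first.
  by rewrite -closed_ballE//; exact: closed_ball_closed.
exists (`|x| + r); split; first exact: num_real.
move=> M xM y /=; rewrite /closed_ball_/= => xy; apply: le_trans (ltW xM).
rewrite -[y in X in X <= _](subrK x) addrC (le_trans (ler_normD _ _))// lerD2l.
by rewrite distrC.
Qed.

End small_balls.

Section step_process_mean_value.
Context {R : realType} {d : nat} {dX : measure_display} {Omega : measurableType dX}.
Local Notation leb := (lebd R d).
Variables (P : euclid R d -> probability Omega R)
  (X : R -> Omega -> option (euclid R d))
  (lambda : euclid R d -> R) (q : euclid R d -> euclid R d -> R) (Q : R).
Hypothesis q_density : forall x, is_density (q x).
Hypothesis q_bounded : forall x y, q x y <= Q.

Let mq x : measurable_fun setT (q x). Proof. by case: (q_density x). Qed.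
Let q0 x y : 0 <= q x y. Proof. by case: (q_density x). Qed.
Let intq x : (\int[leb]_y (q x y)%:E = 1)%E. Proof. by case: (q_density x). Qed.

(** Joint law of the first two positions: with thresholds 0 the waiting times contribute
    [expR 0 = 1], and the third position integrates out. *)
Lemma step_law_two (B0 B1 : set (euclid R d)) x : measurable B1 ->
  (step_law lambda q [:: (B0, 0%R); (B1, 0%R)] x =
   (\1_B0 x)%:E * \int[leb]_(y in B1) (q x y)%:E)%E.
Proof.
move=> mB1; rewrite /= mulr0 oppr0 expR0 mulr1; congr *%E.
rewrite [RHS]integral_mkcond; apply: eq_integral => y _.
under eq_integral do rewrite mule1.
by rewrite intq mule1 mulr0 oppr0 expR0 mulr1 -EFinM epatch_indic/= EFinM.
Qed.

Lemma exit_at_first_jump (Y : nat -> Omega -> euclid R d) (T : nat -> Omega -> R)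
    (h : euclid R d -> R) (D : set (euclid R d)) (w : Omega) :
  (forall k w, 0 < T k w) ->
  (forall k t w, \sum_(i < k) T i w <= t < \sum_(i < k.+1) T i w ->
     X t w = Some (Y k w)) ->
  D (Y 0%N w) -> ~ D (Y 1%N w) ->
  exit_time X D w = (T 0%N w)%:E /\ exit_value X h D w = h (Y 1%N w).
Proof.
move=> T0 XE D0 nD1.
have X1 : X (T 0%N w) w = Some (Y 1%N w).
  by apply: XE; rewrite !big_ord_recl !big_ord0 !addr0 lexx/= ltrDl.
have e : exit_time X D w = (T 0%N w)%:E.
  apply/eqP; rewrite eq_le; apply/andP; split.
    apply: ereal_inf_lbound; exists (T 0%N w) => //; split; first exact: ltW.
    by rewrite X1 => -[y [<-]].
  apply: le_ereal_inf_tmp => _ [t [t0 nt] <-]; rewrite lee_fin leNgt; apply/negP => tT.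
  apply: nt; exists (Y 0%N w) => //; apply: XE.
  by rewrite big_ord0 big_ord_recl big_ord0 addr0 t0.
by split=> //; rewrite /exit_value e/= X1.
Qed.

Lemma step_process_mean_value (h : euclid R d -> R) (D : set (euclid R d)) (M : R) x :
  (0 < d)%N -> regular_step_process P X lambda q ->
  open (D : set 'rV[R]_d) -> harmonic_in P X h D -> (forall y, `|h y| <= M) -> D x ->
  h x = \int[leb]_y (q x y * h y).
Proof.
move=> d0 [_ [Y [T [mYT T0 PE XE _]]]] oD [mh harm] hM Dx.
have M0 : 0 <= M by apply: le_trans (hM x).
have mY k : measurable_fun setT (Y k) by case: (mYT k).
have law B0 B1 : measurable B0 -> measurable B1 ->
  (P x (Y 0%N @^-1` B0 `&` Y 1%N @^-1` B1) = (\1_B0 x)%:E * \int[leb]_(y in B1) (q x y)%:E)%E.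
  move=> mB0 mB1; rewrite -step_law_two// -PE; last first.
    by move=> p [<-//|[<-//|[]]].
  congr (P x _); apply/seteqP; split=> w /=.
    by move=> [? ?]; split=> //.
  by move=> [[? _] [[? _] _]].
have mYB k B : measurable B -> measurable (Y k @^-1` B).
  by move=> mB; rewrite -[X in measurable X]setTI; exact: mY.
pose g w := h (Y 1%N w).
have mg : measurable_fun setT g by exact: measurableT_comp.
have Eg : \int[P x]_w g w = \int[leb]_y (q x y * h y).
  pose m1 : {measure set (euclid R d) -> \bar R} :=
    measure_function_pushforward__canonical__measure_function_Measure (P x) (mY 1%N).
  have m1E A : measurable A -> (m1 A = \int[leb]_(y in A) (q x y)%:E)%E.
    move=> mA; have := law setT A measurableT mA.
    by rewrite preimage_setT setTI indicT mul1e.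
  have H (f : euclid R d -> \bar R) : measurable_fun setT f -> (forall y, 0 <= f y)%E ->
      (\int[P x]_w f (Y 1%N w) = \int[leb]_y (f y * (q x y)%:E))%E.
    move=> mf f0; rewrite -(@ge0_integral_density _ _ _ m1)//.
    by rewrite ge0_integral_pushforward.
  have mEh : measurable_fun setT (EFin \o h) by exact/measurable_EFinP.
  congr fine; rewrite integralE [RHS]integralE; congr (_ - _)%E.
    transitivity (\int[P x]_w (EFin \o h)^\+%E (Y 1%N w))%E.
      by apply: eq_integral => w _; rewrite !funeposE.
    rewrite H//; last exact: measurable_funepos.
    by apply: eq_integral => y _; rewrite !funeposE muleC maxe_pMr ?lee_fin// mule0
      /= -EFinM.
  transitivity (\int[P x]_w (EFin \o h)^\-%E (Y 1%N w))%E.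
    by apply: eq_integral => w _; rewrite !funenegE.
  rewrite H//; last exact: measurable_funeneg.
  by apply: eq_integral => y _; rewrite !funenegE muleC maxe_pMr ?lee_fin// mule0 muleN.
rewrite -Eg; apply/eqP; rewrite -subr_eq0 -normr_le0; apply/ler_addgt0Pl => e e0.
rewrite addr0.
have [eta eta0 Heta] := closed_ball_sub_open oD Dx.
have b1fin : leb (ball (0 : 'rV[R]_d) 1) \is a fin_num.
  by rewrite ge0_fin_numE//; exact: (lebd_ball_fin 0).
pose v := fine (leb (ball (0 : 'rV[R]_d) 1)).
have v0 : 0 <= v by rewrite fine_ge0.
pose c := 2 * M * (`|Q| * v) + 1.
have c0 : 0 < c by rewrite ltr_pwDr// !mulr_ge0.
(* [eta] keeps the closed ball inside [D], 1 gives [r ^+ d <= r] as [d] is positive, and [e / c]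
   brings the error [2 * M * (|Q| * v * r)] below [e]. *)
pose r := Num.min eta (Num.min 1 (e / c)).
have r0 : 0 < r by rewrite !lt_min eta0 ltr01 divr_gt0.
have reta : r <= eta by rewrite ge_min lexx.
have r1 : r <= 1 by rewrite !ge_min lexx orbT.
have rec : r <= e / c by rewrite !ge_min lexx !orbT.
have [rD rK] := Heta r r0 reta.
pose D1 : set (euclid R d) := ball (x : 'rV[R]_d) r.
have mD1 : measurable D1 by exact: measurable_rV_ball.
have D1x : D1 x by exact: ballxx.
have oD1 : open (D1 : set 'rV[R]_d) by exact: ball_open.
have [_ hx] := harm D1 oD1 rK rD x D1x.
pose G : set Omega := Y 0%N @^-1` D1 `&` Y 1%N @^-1` (~` D1).
have mG : measurable G by apply: measurableI; apply: mYB => //; exact: measurableC.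
have GP w : G w -> exit_time X D1 w = (T 0%N w)%:E /\ exit_value X h D1 w = g w.
  by move=> [Y0 Y1]; exact: exit_at_first_jump.
have exitM w : `|exit_value X h D1 w| <= M.
  by rewrite /exit_value; case: (X _ w) => [y|]//=; rewrite normr0.
have GA : G `<=` [set w | (exit_time X D1 w < +oo)%E].
  by move=> w /GP[/= -> _]; exact: ltry.
apply: (le_trans (integral_close mG mg exitM (fun w => hM _) GA
  (fun w Gw => (GP w Gw).2) (esym hx))).
(* The walk starts at [x], which lies in [D1], so [G] fails exactly with the probability that the
   first jump lands in [D1]. *)
have -> : P x (~` G) = (\int[leb]_(y in D1) (q x y)%:E)%E.
  have mEq A : measurable_fun A (fun y => (q x y)%:E).
    by apply/measurable_EFinP; exact: measurable_funTS.
  have mD1c := measurableC mD1.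
  rewrite probability_setC// law// indicE mem_set// mul1e -(intq x) -(setUv D1).
  rewrite ge0_integral_setU//; last 2 first.
  - by move=> y _; rewrite lee_fin.
  - exact/disj_setPCl.
  rewrite addeK// ge0_fin_numE; last by apply: integral_ge0 => y _; rewrite lee_fin.
  apply: (@le_lt_trans _ _ (\int[leb]_y (q x y)%:E)%E); last by rewrite intq ltry.
  by apply: ge0_subset_integral => // y _; rewrite lee_fin.
have qD1 : (\int[leb]_(y in D1) (q x y)%:E <= (`|Q| * v * r)%:E)%E.
  apply: (@le_trans _ _ (\int[leb]_(y in D1) cst (`|Q|%:E) y)%E).
    apply: ge0_le_integral => //.
    - by move=> y _; rewrite lee_fin.
    - by apply/measurable_EFinP; exact: measurable_funTS.
    - by move=> y _; rewrite lee_fin (le_trans (q_bounded x y))// ler_norm.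
  rewrite integral_cst// [X in (_ * X)%E](_ : _ = (r ^+ d * v)%:E); last first.
    by rewrite EFinM /v fineK//; exact: lebd_ball.
  rewrite -EFinM lee_fin.
  rewrite -mulrA ler_wpM2l// mulrC ler_wpM2l//.
  by rewrite -[leRHS]expr1 ler_wiXn2l// ltW.
have qD1' : fine (\int[leb]_(y in D1) (q x y)%:E) <= `|Q| * v * r.
  rewrite -lee_fin fineK// ge0_fin_numE; last by apply: integral_ge0 => y _; rewrite lee_fin.
  exact: le_lt_trans qD1 (ltry _).
apply: (le_trans (ler_wpM2l _ qD1')); first by rewrite mulr_ge0.
apply: (@le_trans _ _ (c * r)); last by rewrite mulrC -ler_pdivlMr.
by rewrite mulrA ler_wpM2r ?(ltW r0)// /c mulrA lerDl.
Qed.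

End step_process_mean_value.

(** * Dilations and the Holder estimate *)

Section dilation.
Context {R : realType} {d : nat}.
Local Notation leb := (lebd R d).
Implicit Types (f : euclid R d -> R).

Lemma measurable_dilate (e : R) f : measurable_fun setT f -> measurable_fun setT (dilate e f).
Proof.
move=> mf; apply: measurable_funM => //.
have := measurableT_comp mf (@measurable_affine R d e^-1 (0 : 'rV[R]_d)).
by apply: eq_measurable_fun => x _ /=; rewrite addr0.
Qed.

Lemma integral_dilate (e : R) f : 0 < e -> measurable_fun setT f -> (forall x, 0 <= f x) ->
  (\int[leb]_x (dilate e f x)%:E = \int[leb]_x (f x)%:E)%E.
Proof.
move=> e0 mf f0.
have mEf : measurable_fun setT (EFin \o f) by exact/measurable_EFinP.
rewrite [RHS](@ge0_integral_affine _ _ e^-1 (0 : 'rV[R]_d) (EFin \o f))//;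
  last by rewrite invr_neq0// gt_eqF.
rewrite -ge0_integralZl//; last 2 first.
- exact: (measurableT_comp mEf (@measurable_affine R d e^-1 (0 : 'rV[R]_d))).
- by move=> x _; rewrite lee_fin f0.
apply: eq_integral => x _; rewrite -EFinM /dilate /= addr0 gtr0_norm ?invr_gt0//.
by rewrite exprVn.
Qed.

Lemma dilate_density (e : R) f : 0 < e -> is_density f -> is_density (dilate e f).
Proof.
move=> e0 [mf f0 f1]; split.
- exact: measurable_dilate.
- by move=> x; rewrite mulr_ge0// invr_ge0 exprn_ge0// ltW.
- by rewrite integral_dilate.
Qed.

Lemma dilate_second_moment (e s : R) f : 0 < e -> is_density f ->
  (\int[leb]_u (enorm u ^+ 2 * f u)%:E = s%:E)%E ->
  (\int[leb]_u (enorm u ^+ 2 * dilate e f u)%:E = (e ^+ 2 * s)%:E)%E.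
Proof.
move=> e0 [mf f0 f1] fs.
have mef : measurable_fun setT (fun u : euclid R d => enorm u ^+ 2 * f u).
  by apply: measurable_funM => //; exact: measurable_enorm2.
have ef0 (u : euclid R d) : 0 <= enorm u ^+ 2 * f u by rewrite mulr_ge0// sqr_ge0.
transitivity (\int[leb]_u (dilate e (fun u => e ^+ 2 * (enorm u ^+ 2 * f u)) u)%:E)%E.
  apply: eq_integral => u _; congr EFin; rewrite /dilate enormZ gtr0_norm ?invr_gt0//.
  have e_neq0 : e != 0 by rewrite gt_eqF.
  by field; rewrite ?expf_neq0 ?e_neq0.
rewrite integral_dilate//; last 2 first.
- exact: measurable_funM.
- by move=> u; rewrite mulr_ge0// sqr_ge0.
under eq_integral do rewrite EFinM.
rewrite ge0_integralZl//.
- by rewrite fs -EFinM.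
- exact/measurable_EFinP.
- by move=> u _; rewrite lee_fin.
- by rewrite lee_fin sqr_ge0.
Qed.

Lemma overlap_dilate (e : R) f (z : 'rV[R]_d) : 0 < e -> is_density f ->
  overlap (dilate e f) z = overlap f (e^-1 *: z : 'rV[R]_d).
Proof.
move=> e0 [mf f0 f1]; congr fine.
rewrite -[RHS](integral_dilate e0); last 2 first.
- by apply: measurable_minr => //; exact: (measurableT_comp mf (measurable_shift_fun _)).
- by move=> u; rewrite le_min !f0.
apply: eq_integral => u _; congr EFin; rewrite /dilate minr_pMr ?invr_ge0 ?exprn_ge0 ?(ltW e0)//.
by rewrite scalerBr.
Qed.

End dilation.

Section holder.
Context {R : realType} {d : nat}.
Local Notation leb := (lebd R d).

(** The topology is that of the sup norm, so openness of Euclidean balls comes from continuity of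
    the Euclidean norm in the coordinates. *)
Lemma open_eball (x0 : 'rV[R]_d) (r : R) : open (eball (x0 : euclid R d) r : set 'rV[R]_d).
Proof.
rewrite (_ : eball _ _ = (fun y : 'rV[R]_d =>
    Num.sqrt (\sum_i (y 0 i - x0 0 i) ^+ 2)) @^-1` [set t | t < r]).
  apply: open_comp; last exact: open_lt.
  move=> y _; apply: (@continuous_comp _ _ _
    (fun y : 'rV[R]_d => \sum_i (y 0 i - x0 0 i) ^+ 2) Num.sqrt).
    apply: continuous_big => [|i _ {}y]; first exact: add_continuous.
    apply: (@continuous_comp _ _ _ (fun y : 'rV[R]_d => y 0 i - x0 0 i) (fun t : R => t ^+ 2)).
      apply: (@continuousB _ _ _ (fun y : 'rV[R]_d => y 0 i) (fun=> x0 0 i)).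
        exact: coord_continuous.
      exact: cst_continuous.
    exact: exprn_continuous.
  exact: sqrt_continuous.
apply/funext => y; rewrite /eball/= /enorm; congr (Num.sqrt _ < r).
by apply: eq_bigr => i _; rewrite /ecoord !mxE.
Qed.

(** Dropping one square in the parallelogram identity bounds [|y - x0|^2] by twice the sum of the
    two squared distances, which is less than [4 r^2]. *)
Lemma ball_sub_eball (x0 x y : euclid R d) (r : R) : 0 < r -> eball x0 r x ->
  enorm ((y : 'rV[R]_d) - x : euclid R d) < r -> eball x0 (2 * r) y.
Proof.
move=> r0; rewrite /eball/= => xr yr.
have sq (u : 'rV[R]_d) (t : R) : 0 < t ->
    (enorm (u : euclid R d) < t) = (enorm (u : euclid R d) ^+ 2 < t ^+ 2).
  by move=> t0; rewrite ltr_pXn2r// ?nnegrE ?enorm_ge0 ?ltW.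
move: xr yr; rewrite !sq ?mulr_gt0// => xr yr.
have := enorm_parallelogram ((y : 'rV[R]_d) - x) ((x : 'rV[R]_d) - x0).
rewrite addrA subrK; have := sqr_ge0 (enorm ((y : 'rV[R]_d) - x - (x - x0) : euclid R d)).
rewrite exprMn; nra.
Qed.

Lemma norm_sup_norm (h : euclid R d -> R) (M : R) z :
  (forall z, `|h z| <= M) -> `|h z| <= sup_norm h.
Proof.
move=> hM; apply: ub_le_sup; last by exists z.
by exists M => _ [u _ <-].
Qed.

Variables (f : euclid R d -> R) (m2 c a e : R).
Hypothesis f_density : is_density f.
Hypothesis f_sym : forall x, f x = f (- (x : 'rV[R]_d)).
Hypothesis f_moment : (\int[leb]_u (enorm u ^+ 2 * f u)%:E = (e ^+ 2 * m2)%:E)%E.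
Hypotheses (e_gt0 : 0 < e) (a_gt0 : 0 < a) (c_gt0 : 0 < c) (m2_ge0 : 0 <= m2).
Hypothesis f_overlap : forall z : 'rV[R]_d, `|z| < a * e -> c <= overlap f z.

(** In the constant, 2 covers the trivial range [S >= 1], [16 * m2] is [8 * m2] for each of [x] and
    [y], and the product is the coupling error. *)
Lemma mean_value_holder (h : euclid R d -> R) (B r : R) (x0 : euclid R d) :
  0 < r -> measurable_fun setT h -> (forall z, `|h z| <= B) ->
  (forall y, eball x0 (2 * r) y -> h y = average f h y) ->
  forall x y, eball x0 r x -> eball x0 r y ->
  `|h x - h y| <= (2 + 16 * m2 + 2 * (1 + c^-1) * (1 + a^-1)) *
     Num.sqrt (Num.max (enorm ((x : 'rV[R]_d) - y : euclid R d)) e / r) * B.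
Proof.
move=> r_gt0 mh hB hav x y xr yr.
have B_ge0 : 0 <= B by apply: le_trans (hB (0 : 'rV[R]_d)).
set D := enorm _; set S := Num.max D e / r.
have D_ge0 : 0 <= D by exact: enorm_ge0.
have S_gt0 : 0 < S by rewrite divr_gt0// lt_max e_gt0 orbT.
have q_gt0 : 0 < Num.sqrt S by rewrite sqrtr_gt0.
set q := Num.sqrt S in q_gt0 *.
have qE : q ^+ 2 = S by rewrite sqr_sqrtr// ltW.
have C_ge0 : 0 <= 16 * m2 + 2 * (1 + c^-1) * (1 + a^-1).
  by rewrite addr_ge0// !mulr_ge0// addr_ge0// invr_ge0 ltW.
have [S_ge1|S_lt1] := leP 1 S.
  apply: (@le_trans _ _ (2 * B)).
    by rewrite (le_trans (ler_normB _ _))// mulr_natl mulr2n lerD.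
  rewrite ler_wpM2r// -[leLHS]mulr1; apply: ler_pM => //.
    by rewrite -addrA lerDl.
  by rewrite -sqrtr1 ler_wsqrtr.
have q_lt1 : q < 1 by rewrite -sqrtr1 ltr_sqrt.
have DS : D <= S * r by rewrite divfK ?gt_eqF// le_max lexx.
have eS : e <= S * r by rewrite divfK ?gt_eqF// le_max lexx orbT.
(* Number of steps shorter than [a * e] leading from [x] to [y]; the successor makes the inequality
   strict and keeps [j] positive when [x = y]. *)
pose j := (Num.truncn (D / (a * e))).+1.
have j_gt : D / (a * e) < j%:R by exact: truncnS_gt.
have j_le : j%:R <= D / (a * e) + 1.
  by rewrite -natr1 lerD2r truncn_le// divr_ge0// mulr_ge0// ltW.
pose z : 'rV[R]_d := j%:R^-1 *: ((y : 'rV[R]_d) - x).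
have jR_gt0 : (0 : R) < j%:R by rewrite ltr0n.
have xyz : y = (x : 'rV[R]_d) + z *+ j.
  by rewrite -scaler_nat scalerA divff ?gt_eqF// scale1r addrC subrK.
have z_small : `|z| < a * e.
  apply: (le_lt_trans (norm_le_enorm z)); rewrite enormZ gtr0_norm ?invr_gt0//.
  rewrite (_ : enorm _ = D); last first.
    by rewrite /D -opprB -scaleN1r enormZ normrN1 mul1r.
  by rewrite mulrC ltr_pdivrMr// mulrC -ltr_pdivrMr// mulr_gt0.
have p_ge := f_overlap z_small.
have p_gt0 : 0 < overlap f z by exact: lt_le_trans p_ge.
have p_le1 := overlap_le1 f_density z.
(* The square root of the intended number of iterations. It is at least 1 because [e <= S * r], so
   rounding it up to [L] at most doubles it. *)
pose t := q * r / e.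
have t_ge1 : 1 <= t.
  rewrite ler_pdivlMr// mul1r (le_trans eS)// ler_wpM2r ?(ltW r_gt0)//.
  by rewrite -qE expr2 ler_piMr ?ltW.
pose L := (Num.truncn t).+1.
have L_gt : t < L%:R by exact: truncnS_gt.
have L_le : L%:R <= 2 * t.
  have : L%:R <= t + 1 by rewrite -natr1 lerD2r truncn_le// (le_trans ler01).
  by move: t_ge1 => /[swap]; lra.
have LR_gt0 : (0 : R) < L%:R by rewrite ltr0n.
have iter_close u : eball x0 r u ->
    `|h u - iter (L ^ 2) (average f) h u| <= 8 * m2 * q * B.
  move=> ur.
  have := local_mean_value_iter f_density f_sym f_moment r_gt0 mh hB
    (fun y' y'u => hav y' (ball_sub_eball r_gt0 ur y'u)) (L ^ 2) u.
  move=> /le_trans; apply.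
  rewrite subrr (_ : enorm _ = 0); last first.
    by rewrite -(scale0r (0 : 'rV[R]_d)) enormZ normr0 mul0r.
  rewrite expr0n/= add0r natrX.
  have -> : L%:R ^+ 2 * (e ^+ 2 * m2) / r ^+ 2 = m2 * (L%:R * e / r) ^+ 2.
    by field; rewrite gt_eqF.
  have Ler : L%:R * e / r <= 2 * q.
    rewrite ler_pdivrMr// -ler_pdivlMr//.
    by apply: (le_trans L_le); rewrite /t !mulrA.
  have Ler0 : 0 <= L%:R * e / r by rewrite !mulr_ge0 ?invr_ge0 ?ltW.
  (* The natural bound is [4 * q ^+ 2]; it is weakened to [4 * q], the order of the coupling
     error. *)
  have Ler2 : (L%:R * e / r) ^+ 2 <= 4 * q.
    apply: (@le_trans _ _ ((2 * q) ^+ 2)).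
      by rewrite ler_pXn2r ?nnegrE// mulr_ge0// ltW.
    rewrite exprMn -natrX ler_wpM2l// expr2 ler_piMl ?ltW//.
  have -> : 8 * m2 * q * B = 2 * B * (m2 * (4 * q)) by ring.
  by rewrite ler_wpM2l ?mulr_ge0// ler_wpM2l.
have coupled : `|iter (L ^ 2) (average f) h x - iter (L ^ 2) (average f) h y| <=
    2 * (1 + c^-1) * (1 + a^-1) * q * B.
  rewrite xyz; apply: (le_trans (coupling_iter f_density mh hB p_gt0 (L ^ 2) j x)).
  have L2 : (0 < L ^ 2)%N by rewrite expn_gt0.
  have := survival_bound p_gt0 p_le1 j (ltn0Sn _ : (0 < L)%N) L2.
  rewrite natrX.
  (* With [L ^ 2] iterations and barrier [L], both terms of [survival_bound] are multiples of
     [j / L]. *)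
  have -> : j%:R / L%:R + j%:R * L%:R / (overlap f z * L%:R ^+ 2) =
      (j%:R / L%:R) * (1 + (overlap f z)^-1) :> R.
    by field; rewrite !gt_eqF.
  move=> sb.
  have jL : j%:R / L%:R <= (1 + a^-1) * q.
    rewrite ler_pdivrMr//; apply: (le_trans j_le).
    apply: (@le_trans _ _ ((1 + a^-1) * (q * t))).
      (* The first term absorbs [D / (a * e)], the second the 1 due to rounding in [j]; the latter
         uses [e <= S * r], that is, the lower cutoff at scale [e]. *)
      have -> : (1 + a^-1) * (q * t) = (S * r) / (a * e) + (S * r) / e.
        by rewrite -qE /t; field; rewrite !gt_eqF.
      apply: lerD; first by rewrite ler_wpM2r// invr_ge0 mulr_ge0 ?ltW.
      by rewrite ler_pdivlMr// mul1r.
    by rewrite -mulrA ler_wpM2l ?addr_ge0 ?invr_ge0 ?(ltW a_gt0)// ler_wpM2l ?(ltW q_gt0)// ltW.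
  have pc : 1 + (overlap f z)^-1 <= 1 + c^-1.
    by rewrite lerD2l lef_pV2 ?posrE.
  have -> : 2 * (1 + c^-1) * (1 + a^-1) * q * B = 2 * B * (((1 + a^-1) * q) * (1 + c^-1)) by ring.
  rewrite ler_wpM2l ?mulr_ge0//; apply: (le_trans sb).
  by apply: ler_pM => //; rewrite addr_ge0// invr_ge0 ltW.
have hx := iter_close x xr; have hy := iter_close y yr.
have -> : h x - h y = (h x - iter (L ^ 2) (average f) h x) +
  (iter (L ^ 2) (average f) h x - iter (L ^ 2) (average f) h y) -
  (h y - iter (L ^ 2) (average f) h y) by ring.
apply: (le_trans (ler_normB _ _)).
apply: (@le_trans _ _ (8 * m2 * q * B + 2 * (1 + c^-1) * (1 + a^-1) * q * B + 8 * m2 * q * B)).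
  by rewrite lerD// (le_trans (ler_normD _ _))// lerD.
rewrite -subr_ge0 (_ : _ - _ = 2 * (q * B)); last by ring.
by rewrite !mulr_ge0// ltW.
Qed.

End holder.

Theorem proposition4p7 (R : realType) (d : nat) (d_ge1 : (1 <= d)%N)
  (* the density rho *)
  (rho : euclid R d -> R) (sigma : R)
  (rho_density : is_density rho)
  (rho_sym : forall x, rho x = rho (- x))
  (sigma_gt0 : 0 < sigma)
  (rho_cov : forall i j : 'I_d,
    (\int[lebd R d]_x (ecoord x i * ecoord x j * rho x)%:E
     = (sigma ^+ 2 * (i == j)%:R)%:E)%E)
  (rho_bounded : exists M : R, forall x, rho x <= M)
  (rho_moment : exists2 delta : R, 0 < delta &
    (\int[lebd R d]_x
       (enorm x `^ Num.max 2 (d%:R - 2 + delta) * rho x)%:E < +oo)%E)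
  (* standard Brownian motion W *)
  (dW : measure_display) (OmegaW : measurableType dW)
  (PW : euclid R d -> probability OmegaW R)
  (W : R -> OmegaW -> euclid R d) (theta : R -> OmegaW -> OmegaW)
  (W_bm : brownian_motion PW W theta)
  (* the measure mu *)
  (mu : {measure set (euclid R d) -> \bar R})
  (mu_radon : radon mu)
  (mu_polar : charges_no_polar mu)
  (mu_fqs : full_quasi_support PW W theta mu)
  (* the density phi *)
  (phi : euclid R d -> R)
  (phi_density : is_density phi)
  (phi_bounded : exists M : R, forall x, phi x <= M)
  (phi_supp : compactly_supported phi)
  (phi_grad : exists (G : 'I_d -> euclid R d -> R) (C' : R),
    [/\ weak_gradient phi G, 0 < C' &
        {ae lebd R d, forall x,
           Num.sqrt (\sum_i G i x ^+ 2) <= C' * rho x}])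
  (* the scales r_n, n >= 1 *)
  (rn : nat -> R)
  (rn_itv : forall n, (1 <= n)%N -> 0 < rn n <= 1)
  (rn_dec : forall m n, (1 <= m)%N -> (m <= n)%N -> rn n <= rn m)
  (rn_lim : rn @ \oo --> 0)
  (* the processes X^n *)
  (dX : measure_display) (OmegaX : nat -> measurableType dX)
  (PX : forall n, euclid R d -> probability (OmegaX n) R)
  (X : forall n, R -> OmegaX n -> option (euclid R d))
  (X_walk : forall n, (1 <= n)%N ->
    time_changed_walk rho sigma phi mu (rn n) (PX n) (X n)) :
  exists gamma' c0 C : R, [/\ 0 < gamma', 0 < c0, 0 < C &
    forall (n : nat) (x0 : euclid R d) (r : R) (h : euclid R d -> R),
      (1 <= n)%N -> 0 < r ->
      (exists M : R, forall z, `|h z| <= M) ->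
      harmonic_in (PX n) (X n) h (eball x0 (2 * r)) ->
      forall x y, eball x0 r x -> eball x0 r y ->
        `|h x - h y| <=
          C * (Num.max (enorm (x - y)) (c0 * rn n) / r) `^ gamma' * sup_norm h].
Proof.
have [mrho rho0 rho1] := rho_density.
have [Q HQ] := rho_bounded.
have rho_pos : (0 < \int[lebd R d]_x (rho x)%:E)%E by rewrite rho1 lte01.
have [a [c [a0 c0 Hac]]] := translate_overlap mrho rho0 rho_pos.
(* The trace of the covariance matrix. *)
have rho_m2 : (\int[lebd R d]_u (enorm u ^+ 2 * rho u)%:E = (d%:R * sigma ^+ 2)%:E)%E.
  transitivity (\int[lebd R d]_u (\sum_(i < d) (ecoord u i * ecoord u i * rho u)%:E))%E.
    apply: eq_integral => u _; rewrite sumEFin -mulr_suml; congr (_ * _)%:E.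
    by rewrite enorm2E; apply: eq_bigr => i _; rewrite -expr2.
  rewrite ge0_integral_sum//; last 2 first.
  - move=> i; apply/measurable_EFinP; apply: measurable_funM => //.
    by apply: measurable_funM; exact: measurable_ecoord.
  - by move=> i u _; rewrite lee_fin mulr_ge0// -expr2 sqr_ge0.
  under eq_bigr do rewrite rho_cov eqxx mulr1.
  by rewrite sumEFin sumr_const card_ord mulr_natl.
pose m2 := d%:R * sigma ^+ 2.
have m2_ge0 : 0 <= m2 by rewrite mulr_ge0// sqr_ge0.
have C_gt0 : 0 < 2 + 16 * m2 + 2 * (1 + c^-1) * (1 + a^-1).
  rewrite ltr_pwDl//; first by rewrite ltr_pwDl// mulr_ge0.
  by rewrite !mulr_ge0// addr_ge0// invr_ge0 ltW.
exists 2^-1, 1, (2 + 16 * m2 + 2 * (1 + c^-1) * (1 + a^-1)); split => //.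
move=> n x0 r h n1 r0 [M hM] harm x y xr yr.
have /andP[e0 _] := rn_itv n n1.
set e := rn n in e0 *.
have f_density := dilate_density e0 rho_density.
set f := dilate e rho in f_density.
have [mf f0 f1] := f_density.
have f_sym u : f u = f (- (u : 'rV[R]_d)).
  by rewrite /f /dilate scalerN -rho_sym.
have f_m2 := dilate_second_moment e0 rho_density rho_m2.
(* Dilation rescales the admissible [z] but not the overlap, so [a] and [c] are the same for every
   [n]. *)
have f_overlap z : `|z : 'rV[R]_d| < a * e -> c <= overlap f z.
  move=> za; rewrite overlap_dilate// -lee_fin /overlap fineK.
    apply: Hac; rewrite normrZ gtr0_norm ?invr_gt0// mulrC ltr_pdivrMr//.
  rewrite ge0_fin_numE; last by apply: integral_ge0 => u _; rewrite lee_fin le_min !rho0.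
  apply: (@le_lt_trans _ _ (\int[lebd R d]_x (rho x)%:E)%E); last by rewrite rho1 ltry.
  apply: ge0_le_integral_nonmeasurable => u; rewrite lee_fin ?ge_min ?lexx//.
  by rewrite le_min !rho0.
have [mh _] := harm.
have hB := norm_sup_norm _ hM.
rewrite mul1r powR12_sqrt; last first.
  by rewrite divr_ge0 ?(ltW r0)// le_max (ltW e0) orbT.
apply: (mean_value_holder f_density f_sym f_m2 e0 a0 c0 m2_ge0 f_overlap r0 mh hB _ xr yr).
move=> u ur.
pose q v w := f ((w : euclid R d) - (v : 'rV[R]_d) : 'rV[R]_d).
have q_density v : is_density (q v).
  split.
  - exact: (measurableT_comp mf (measurable_shift_fun v)).
  - by move=> w; exact: f0.
  - rewrite (@integral_shift _ _ (- (v : 'rV[R]_d)) (EFin \o f))//; exact/measurable_EFinP.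
(* This bound degenerates with the scale, but it only serves to let a radius tend to 0 at fixed [n],
   so the final constant does not depend on it. *)
have q_bounded v w : q v w <= e ^- d * Q.
  by rewrite ler_wpM2l// invr_ge0 exprn_ge0// ltW.
rewrite (step_process_mean_value q_density q_bounded d_ge1 (X_walk n n1)
  (@open_eball R d x0 (2 * r)) harm hM ur).
congr fine; rewrite -(@integral_shift _ _ u (fun w => (q u w * h w)%:E)).
  by apply: eq_integral => w _; rewrite /q addrK addrC.
apply/measurable_EFinP; apply: measurable_funM => //.
by case: (q_density u).
Qed.
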